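(* Let $X$ be an edge-end space, i.e. a topological space homeomorphic to $\Omega_E(G)$ for some connected graph $G$. Then the following are equivalent: (1) $X$ is first countable; (2) $X$ is metrizable; (3) $X$ is completely ultrametrizable; (4) $X$ is homeomorphic to the end space $\Omega(T)=\Omega_E(T)$ of some graph-theoretic tree $T$.
   Context: Graphs may be infinite. A ray is a one-way infinite path. Two rays of a graph $G=(V,E)$ are edge-equivalent if no finite set of edges separates them; the equivalence classes are the edge-ends of $G$, forming the set $\Omega_E(G)$. A region of $G$ is a connected induced subgraph $C$ whose boundary $\partial C=\{xy\in E: x\in C, y\notin C\}$ is finite (e.g. any component of $G-F$ for a finite $F\subseteq E$). For a region $C$, $\Omega_E(C)$ is the set of edge-ends having a ray contained in $C$ (equivalently, all of whose rays have a tail in $C$). The sets $\Omega_E(C)$, $C$ a region of $G$, form a basis of the topology of the edge-end space $\Omega_E(G)$. For a tree $T$, vertex-equivalence (no finite vertex set separates the rays) and edge-equivalence coincide, so the end space $\Omega(T)$ equals $\Omega_E(T)$ with this topology. *)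

(* Defs.v *)
From Stdlib Require Import Reals List Relations.
From mathcomp Require Import all_boot classical_sets topology.
Local Open Scope classical_set_scope.



Unset Printing Implicit Defensive.

Definition simple_graph {V : Type} (adj : V -> V -> Prop) : Prop :=
  (forall x y, adj x y -> adj y x) /\ (forall x, ~ adj x x).

Definition connected_graph {V : Type} (adj : V -> V -> Prop) : Prop :=
  forall x y : V, clos_refl_trans V adj x y.

Definition acyclic {V : Type} (adj : V -> V -> Prop) : Prop :=
  forall (n : nat) (c : nat -> V),
    Peano.le 3 n ->
    (forall i j, Peano.lt i n -> Peano.lt j n -> c i = c j -> i = j) ->
    (forall i, Peano.lt (S i) n -> adj (c i) (c (S i))) ->
    ~ adj (c (Nat.pred n)) (c 0%nat).

Definition is_tree {V : Type} (adj : V -> V -> Prop) : Prop :=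
  simple_graph adj /\ connected_graph adj /\ acyclic adj.

Record ray {V : Type} (adj : V -> V -> Prop) := Ray {
  ray_fun :> nat -> V;
  ray_inj : forall m n, ray_fun m = ray_fun n -> m = n;
  ray_adj : forall n, adj (ray_fun n) (ray_fun (S n)) }.

(* Finite edge sets are given by finite lists of (ordered) vertex pairs;
   the edge xy belongs to F if (x,y) or (y,x) is listed. *)
Definition edge_in {V : Type} (F : list (V * V)) (x y : V) : Prop :=
  In (x, y) F \/ In (y, x) F.

Definition adj_minus {V : Type} (adj : V -> V -> Prop) (F : list (V * V))
  (x y : V) : Prop := adj x y /\ ~ edge_in F x y.

(* F separates r1 and r2 unless they have tails in the same component of
   G - F.  Edge-equivalence: no finite edge set separates them. *)
Definition edge_equiv {V : Type} (adj : V -> V -> Prop) (r1 r2 : ray adj) : Prop :=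
  forall F : list (V * V), exists N : nat, forall m n : nat,
    Peano.le N m -> Peano.le N n -> clos_refl_trans V (adj_minus adj F) (r1 m) (r2 n).

Definition edge_end {V : Type} (adj : V -> V -> Prop) : Type :=
  { E : ray adj -> Prop | exists r : ray adj, forall r', E r' <-> edge_equiv adj r r' }.

Definition region {V : Type} (adj : V -> V -> Prop) (C : V -> Prop) : Prop :=
  (exists v, C v) /\
  (forall x y, C x -> C y ->
     clos_refl_trans V (fun a b => C a /\ C b /\ adj a b) x y) /\
  (exists l : list (V * V), forall x y, C x -> ~ C y -> adj x y -> In (x, y) l).

Definition end_in_region {V : Type} (adj : V -> V -> Prop) (C : V -> Prop)
  (w : edge_end adj) : Prop :=
  exists r : ray adj, proj1_sig w r /\ forall n, C (r n).

Definition end_open {V : Type} (adj : V -> V -> Prop) (U : edge_end adj -> Prop) : Prop :=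
  forall w, U w -> exists C : V -> Prop,
    region adj C /\ end_in_region adj C w /\
    (forall w', end_in_region adj C w' -> U w').

Definition homeomorphic_to_ends (X : topologicalType) {V : Type}
  (adj : V -> V -> Prop) : Prop :=
  exists f : X -> edge_end adj,
    bijective f /\ forall U : set X, open U <-> end_open adj (f @` U).

Definition first_countable (X : topologicalType) : Prop :=
  forall x : X, exists B : nat -> set X,
    (forall n, open (B n) /\ B n x) /\
    (forall U : set X, open U -> U x -> exists n, B n `<=` U).

Definition is_metric {X : Type} (d : X -> X -> Rdefinitions.R) : Prop :=
  (forall x y, Rle R0 (d x y)) /\
  (forall x y, d x y = R0 <-> x = y) /\
  (forall x y, d x y = d y x) /\
  (forall x y z, Rle (d x z) (Rplus (d x y) (d y z))).

Definition is_ultrametric {X : Type} (d : X -> X -> Rdefinitions.R) : Prop :=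
  forall x y z, Rle (d x z) (Rmax (d x y) (d y z)).

Definition metric_induces {X : topologicalType} (d : X -> X -> Rdefinitions.R) : Prop :=
  forall U : set X, open U <->
    (forall x, U x -> exists e : Rdefinitions.R, Rlt R0 e /\ forall y, Rlt (d x y) e -> U y).

Definition complete_metric {X : Type} (d : X -> X -> Rdefinitions.R) : Prop :=
  forall u : nat -> X,
    (forall e : Rdefinitions.R, Rlt R0 e -> exists N, forall m n, Peano.le N m -> Peano.le N n -> Rlt (d (u m) (u n)) e) ->
    exists l : X, forall e : Rdefinitions.R, Rlt R0 e -> exists N, forall n, Peano.le N n -> Rlt (d (u n) l) e.

Definition metrizable (X : topologicalType) : Prop :=
  exists d : X -> X -> Rdefinitions.R, is_metric d /\ metric_induces d.

Definition completely_ultrametrizable (X : topologicalType) : Prop :=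
  exists d : X -> X -> Rdefinitions.R,
    is_metric d /\ is_ultrametric d /\ metric_induces d /\ complete_metric d.

(* Main.v *)
(* Only the passage from first countable to completely ultrametrizable is not
   routine.  Split the vertex set recursively into regions.  A region [C] at depth
   [n] carries a finite list of vertices that contains the inner ends of its
   boundary edges and those of its predecessors.  For each listed [v], if [v] is
   not separated from some end by finitely many edges, cut along the boundary of
   the [n]-th member of a countable neighbourhood basis of that end; otherwise
   delete the whole class of vertices infinitely edge-connected to [v].  The
   resulting components have finite boundary, since a connected set sending
   infinitely many edges to such a class yields an end that [v] dominates.
   Along a branch of this recursion, either no vertex survives, and a ray running
   through the nested regions gives the only end in all of them, or a listed vertex
   survives, and the branch shrinks to the end it dominates.  So the partitions of
   the end space at depths 0, 1, 2, ... define a complete ultrametric, and their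
   classes ordered by inclusion form a tree with the same end space. *)

Require Import Defs.
From mathcomp Require Import boolp classical_sets topology.
From Stdlib Require Import Reals List Relations Lia Lra.
From Stdlib Require Import Classical ClassicalEpsilon.
Import ListNotations.


(** * Extrema of natural numbers and finiteness of predicates *)

Lemma least_nat (P : nat -> Prop) :
  (exists n, P n) -> exists n, P n /\ forall m, m < n -> ~ P m.
Proof.
intros [n Pn]; apply NNPP; intros none.
assert (H : forall k m, m <= k -> ~ P m).
{ induction k as [|k IH]; intros m Hm Pm; apply none; exists m; split; auto.
  - intros; lia.
  - intros j Hj; apply IH; lia. }
exact (H n n (le_n n) Pn).
Qed.

Lemma argmax_nat (g : nat -> nat) (n : nat) :
  0 < n -> exists i, i < n /\ forall j, j < n -> g j <= g i.
Proof.
induction n as [|n IH]; intros Hn; [lia|].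
destruct (Nat.eq_dec n 0) as [->|n0].
{ exists 0; split; [lia|intros j Hj; replace j with 0 by lia; lia]. }
destruct IH as [i [Hi Mi]]; [lia|].
destruct (Nat.le_gt_cases (g n) (g i)).
- exists i; split; [lia|]; intros j Hj.
  destruct (Nat.eq_dec j n) as [->|]; [lia|apply Mi; lia].
- exists n; split; [lia|]; intros j Hj.
  destruct (Nat.eq_dec j n) as [->|]; [lia|specialize (Mi j); lia].
Qed.

Definition finitely_many {T : Type} (P : T -> Prop) : Prop :=
  exists l : list T, forall p, P p -> In p l.

Lemma finitely_many_sub {T : Type} (P Q : T -> Prop) :
  (forall p, P p -> Q p) -> finitely_many Q -> finitely_many P.
Proof. intros PQ [l Hl]; exists l; auto. Qed.

Lemma finitely_many_or {T : Type} (P Q : T -> Prop) :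
  finitely_many P -> finitely_many Q -> finitely_many (fun p => P p \/ Q p).
Proof.
intros [l Hl] [m Hm]; exists (List.app l m); intros p [Hp|Hp]; apply in_or_app; auto.
Qed.

Lemma finitely_many_exists_in {S T : Type} (l : list S) (P : S -> T -> Prop) :
  (forall s, In s l -> finitely_many (P s)) ->
  finitely_many (fun p => exists s, In s l /\ P s p).
Proof.
induction l as [|s l IH]; intros H.
- exists nil; intros p [s [[] _]].
- destruct IH as [m Hm]; [intros; apply H; now right|].
  destruct (H s) as [k Hk]; [now left|].
  exists (List.app k m); intros p [t [[<-|Ht] Hp]]; apply in_or_app; eauto.
Qed.

(** * Reflexive-transitive closures *)

Section Closure.
Context {T : Type}.
Implicit Types (R : T -> T -> Prop) (P Z : T -> Prop).

Lemma rtc_mono R R' x y :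
  (forall a b, R a b -> R' a b) ->
  clos_refl_trans T R x y -> clos_refl_trans T R' x y.
Proof.
intros H; induction 1; [apply rt_step; auto|apply rt_refl|eapply rt_trans; eauto].
Qed.

Lemma rtc_sym R x y :
  (forall a b, R a b -> R b a) ->
  clos_refl_trans T R x y -> clos_refl_trans T R y x.
Proof.
intros H; induction 1; [apply rt_step; auto|apply rt_refl|eapply rt_trans; eauto].
Qed.

Lemma rtc_stable R P x y :
  (forall a b, R a b -> P a -> P b) ->
  clos_refl_trans T R x y -> P x -> P y.
Proof. intros H; induction 1; eauto. Qed.

Lemma rtc_exit R P x y :
  clos_refl_trans T R x y -> P x -> ~ P y ->
  exists a b, clos_refl_trans T (fun u v => R u v /\ P u /\ P v) x a /\
    R a b /\ P a /\ ~ P b.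
Proof.
intros H; apply clos_rt_rt1n in H.
induction H as [x|x z y xz zy IH]; [tauto|intros Px Py].
destruct (classic (P z)) as [Pz|Pz].
- destruct (IH Pz Py) as [a [b [H1 H2]]]; exists a, b; split; auto.
  apply rt_trans with z; auto; apply rt_step; auto.
- exists x, z; split; [apply rt_refl|auto].
Qed.

Lemma rtc_last R x y :
  clos_refl_trans T R x y -> x = y \/ exists z, R z y.
Proof.
intros H; apply clos_rt_rtn1 in H; destruct H as [|z y zy _]; eauto.
Qed.

Lemma rtc_finite_support R x y :
  clos_refl_trans T R x y ->
  exists l : list T, clos_refl_trans T (fun a b => R a b /\ In a l) x y.
Proof.
induction 1 as [x y xy|x|x y z _ [l Hl] _ [m Hm]].
- exists [x]; apply rt_step; split; auto; now left.
- exists nil; apply rt_refl.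
- exists (List.app l m); apply rt_trans with y.
  + revert Hl; apply rtc_mono; intros a b []; split; auto; apply in_or_app; auto.
  + revert Hm; apply rtc_mono; intros a b []; split; auto; apply in_or_app; auto.
Qed.

Fixpoint reaches_in R Z (k : nat) (x : T) : Prop :=
  match k with
  | 0 => Z x
  | S k => exists y, R x y /\ reaches_in R Z k y
  end.

Definition reaches R Z (x : T) : Prop := exists z, clos_refl_trans T R x z /\ Z z.

Lemma reachesP R Z x : reaches R Z x <-> exists k, reaches_in R Z k x.
Proof.
split.
- intros [z [H Zz]]; apply clos_rt_rt1n in H.
  induction H as [x|x y z xy _ IH]; [now exists 0|].
  destruct (IH Zz) as [k Hk]; exists (S k), y; auto.
- intros [k Hk]; revert x Hk; induction k as [|k IH]; intros x; simpl.
  + intros Zx; exists x; split; auto; apply rt_refl.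
  + intros [y [xy Hy]]; destruct (IH y Hy) as [z [yz Zz]]; exists z; split; auto.
    apply rt_trans with y; auto; now apply rt_step.
Qed.

(** The value at [x] is the length of a shortest [R]-walk to [Z]; the second vertex of such a walk
    is exactly one closer. Points that do not reach [Z] get an arbitrary value. *)
Lemma distance_exists R Z :
  exists f : T -> nat, forall x, reaches R Z x ->
    (f x = 0 -> Z x) /\
    (f x <> 0 -> exists y, R x y /\ reaches R Z y /\ f x = S (f y)).
Proof.
assert (H : forall x, exists k, reaches R Z x ->
  reaches_in R Z k x /\ forall m, m < k -> ~ reaches_in R Z m x).
{ intros x; destruct (classic (reaches R Z x)) as [Hx|Hx].
  - destruct (least_nat _ (proj1 (reachesP R Z x) Hx)) as [k Hk]; exists k; auto.
  - exists 0; tauto. }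
apply boolp.choice in H; destruct H as [f Hf]; exists f; intros x Hx.
destruct (Hf x Hx) as [H1 H2]; split; intros Fx.
- now rewrite Fx in H1.
- destruct (f x) as [|k]; [easy|destruct H1 as [y [xy Hy]]].
  assert (Ry : reaches R Z y) by (apply reachesP; eauto).
  exists y; split; auto; split; auto; f_equal.
  destruct (Hf y Ry) as [H3 H4].
  destruct (Nat.lt_trichotomy k (f y)) as [L|[L|L]]; auto.
  + now apply H4 in L.
  + exfalso; apply (H2 (S (f y))); [lia|exists y; auto].
Qed.

End Closure.

(** * Rays, regions and tails *)

Section Graph.
Context {V : Type} {adj : V -> V -> Prop}.
Hypothesis adj_sym : forall x y, adj x y -> adj y x.

Implicit Types (F : list (V * V)) (C D U : V -> Prop) (r : ray adj).

Local Notation conn F := (clos_refl_trans V (adj_minus adj F)).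

Definition inside (C : V -> Prop) (a b : V) : Prop := C a /\ C b /\ adj a b.

Definition connected_in C : Prop :=
  forall x y, C x -> C y -> clos_refl_trans V (inside C) x y.

Definition tail_in r C : Prop := exists N, forall m, N <= m -> C (r m).

Lemma edge_in_sym F x y : edge_in F x y -> edge_in F y x.
Proof. unfold edge_in; tauto. Qed.

Lemma adj_minus_sym F x y : adj_minus adj F x y -> adj_minus adj F y x.
Proof. intros [H1 H2]; split; auto; intros H; now apply H2, edge_in_sym. Qed.

Lemma conn_sym F x y : conn F x y -> conn F y x.
Proof. apply rtc_sym, adj_minus_sym. Qed.

(** Once its finitely many boundary edges are deleted, a region is a union of components. Many
    arguments below use the finite boundary only in this form. *)
Lemma region_boundary C :
  region adj C -> exists F, forall x y, conn F x y -> C x -> C y.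
Proof.
intros [_ [_ [l Hl]]]; exists l; intros x y; apply rtc_stable.
intros a b [ab nF] Ca; apply NNPP; intros nCb; apply nF; left; auto.
Qed.

(** A walk inside [D] uses no edge of [F], so [D] stays within one component of the graph minus
    [F]. *)
Lemma connected_in_absorbed C D F :
  connected_in D ->
  (forall x y, conn F x y -> C x -> C y) ->
  (forall x y, D x -> ~ edge_in F x y) ->
  (exists x, C x /\ D x) -> forall y, D y -> C y.
Proof.
intros cD CF DF [x [Cx Dx]] y Dy; apply CF with x; auto.
generalize (cD x y Dx Dy); apply rtc_mono.
intros a b [Da [Db ab]]; split; auto.
Qed.

Lemma component_region F x : region adj (conn F x).
Proof.
split; [exists x; apply rt_refl|split].
- intros a b xa xb.
  assert (ab : conn F a b) by (apply rt_trans with x; [apply conn_sym|]; assumption).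
  apply clos_rt_rt1n in ab; induction ab as [|a c b ac _ IH]; [apply rt_refl|].
  assert (xc : conn F x c) by (apply rt_trans with a; [|apply rt_step]; assumption).
  apply rt_trans with c; auto; apply rt_step; split; auto; split; auto; apply ac.
(* A boundary pair has its inner end first, while [F] may hold either orientation; hence both are
   listed. *)
- exists (List.app F (List.map (fun p => (snd p, fst p)) F)); intros a b xa xb ab.
  apply in_or_app; apply NNPP; intros H; apply xb.
  apply rt_trans with a; auto; apply rt_step; split; auto.
  intros [Fab|Fba]; apply H; auto.
  right; apply in_map_iff; exists (b, a); auto.
Qed.

Lemma ray_leaves r (l : list V) : exists N, forall m, N <= m -> ~ In (r m) l.
Proof.
induction l as [|v l [N HN]]; [exists 0; auto|].
destruct (classic (exists k, r k = v)) as [[k Hk]|H].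
- exists (S k + N); intros m Hm [E|E]; [|apply (HN m); auto; lia].
  rewrite <- Hk in E; apply ray_inj in E; lia.
- exists N; intros m Hm [E|E]; [eauto|now apply (HN m)].
Qed.

Definition endpoints F : list V :=
  List.app (List.map fst F) (List.map snd F).

Lemma edge_in_endpoints F x y : edge_in F x y -> In x (endpoints F).
Proof.
intros [H|H]; apply in_or_app; [left|right]; apply in_map_iff;
  eexists; split; eauto; reflexivity.
Qed.

Lemma ray_tail_rtc (Q : V -> V -> Prop) r N :
  (forall a b, Q a b -> Q b a) ->
  (forall m, N <= m -> Q (r m) (r (S m))) ->
  forall m n, N <= m -> N <= n -> clos_refl_trans V Q (r m) (r n).
Proof.
intros Qs HN.
assert (H : forall d m, N <= m -> clos_refl_trans V Q (r m) (r (d + m))).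
{ induction d as [|d IH]; intros m Hm; [apply rt_refl|].
  eapply rt_trans; [apply IH; auto|apply rt_step; apply HN; lia]. }
intros m n Hm Hn; destruct (Nat.le_ge_cases m n) as [L|L].
- replace n with ((n - m) + m) by lia; auto.
- apply rtc_sym; auto; replace m with ((m - n) + n) by lia; auto.
Qed.

(** [F] has finitely many endpoints, and a ray visits each of them at most once. *)
Lemma ray_tail_conn r F :
  exists N, forall m n, N <= m -> N <= n -> conn F (r m) (r n).
Proof.
destruct (ray_leaves r (endpoints F)) as [N HN]; exists N.
apply ray_tail_rtc; [apply adj_minus_sym|].
intros m Hm; split; [apply ray_adj|]; intros E.
now apply (HN m Hm), (edge_in_endpoints F _ (r (S m))).
Qed.

Lemma ray_tail_region r C :
  region adj C -> exists N, forall m n, N <= m -> N <= n -> C (r m) -> C (r n).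
Proof.
intros rC; destruct (region_boundary C rC) as [F HF].
destruct (ray_tail_conn r F) as [N HN]; exists N; eauto.
Qed.

Lemma edge_equiv_sym r1 r2 : edge_equiv adj r1 r2 -> edge_equiv adj r2 r1.
Proof.
intros H F; destruct (H F) as [N HN]; exists N; intros m n Hm Hn.
apply conn_sym; auto.
Qed.

Lemma edge_equiv_trans r1 r2 r3 :
  edge_equiv adj r1 r2 -> edge_equiv adj r2 r3 -> edge_equiv adj r1 r3.
Proof.
intros H1 H2 F; destruct (H1 F) as [N HN]; destruct (H2 F) as [M HM].
exists (N + M); intros m n Hm Hn; apply rt_trans with (r2 (N + M)).
- apply HN; lia.
- apply HM; lia.
Qed.

Lemma edge_equiv_tail r1 r2 C :
  edge_equiv adj r1 r2 -> region adj C -> tail_in r1 C -> tail_in r2 C.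
Proof.
intros H rC [M HM]; destruct (region_boundary C rC) as [F HF].
destruct (H F) as [N HN]; exists (N + M); intros m Hm.
apply HF with (r1 (N + M)); [apply HN|apply HM]; lia.
Qed.

(* This is the Hausdorff property of the edge-end space. *)
Lemma edge_equiv_of_tails r1 r2 :
  (forall C, region adj C -> tail_in r1 C -> tail_in r2 C) -> edge_equiv adj r1 r2.
Proof.
intros H F; destruct (ray_tail_conn r1 F) as [N HN].
(* The test region is the component of the graph minus [F] that holds a tail of [r1]. *)
destruct (H (conn F (r1 N))) as [M HM].
- apply component_region.
- exists N; auto.
- exists (N + M); intros m n Hm Hn; apply rt_trans with (r1 N).
  + apply HN; lia.
  + apply HM; lia.
Qed.

Definition shift_ray r (N : nat) : ray adj.
Proof.
refine (Ray V adj (fun m => r (N + m)) _ _).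
- intros m n E; apply ray_inj in E; lia.
- intros m; rewrite Nat.add_succ_r; apply ray_adj.
Defined.

Lemma edge_equiv_shift r N : edge_equiv adj r (shift_ray r N).
Proof.
intros F; destruct (ray_tail_conn r F) as [M HM]; exists M; intros m n Hm Hn.
apply HM; lia.
Qed.

(** * Nested connected sets *)

Section NestedSets.
Variable D : nat -> V -> Prop.
Hypothesis D_decr : forall n x, D (S n) x -> D n x.
Hypothesis D_void : forall x, exists n, ~ D n x.

Lemma nested_le m n x : m <= n -> D n x -> D m x.
Proof. induction 1; auto. Qed.

Lemma nested_avoids (l : list V) : exists N, forall x, D N x -> ~ In x l.
Proof.
induction l as [|v l [N HN]]; [exists 0; auto|].
destruct (D_void v) as [M HM]; exists (N + M); intros x Dx [<-|xl].
- apply HM; revert Dx; apply nested_le; lia.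
- apply (HN x); auto; revert Dx; apply nested_le; lia.
Qed.

Hypothesis D_conn : forall n, connected_in (D n).
Hypothesis D_inh : forall n, exists x, D n x.

(* From a vertex of D n outside D (n+1), step towards D (n+1) inside D n.  Along
   this walk the pair (n, - distance to D (n+1)) increases lexicographically, so
   the walk is a ray. *)
Lemma nested_ray : exists r, forall n, tail_in r (D n).
Proof.
assert (Hd : forall n, exists f : V -> nat, forall x, D n x -> ~ D (S n) x ->
  exists y, adj x y /\ D n y /\ f y < f x).
{ intros n; destruct (distance_exists (inside (D n)) (D (S n))) as [f Hf].
  exists f; intros x Dx nDx; destruct (D_inh (S n)) as [z Dz].
  assert (Hx : reaches (inside (D n)) (D (S n)) x).
  { exists z; split; auto; apply D_conn; auto. }
  destruct (Hf x Hx) as [H1 H2].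
  destruct H2 as [y [[_ [Dy xy]] [_ E]]]; [tauto|].
  exists y; repeat split; auto; lia. }
apply boolp.choice in Hd; destruct Hd as [f Hf].
(* [rk x] is the depth of [x], the last [n] with [D n x]. *)
assert (Hrk : forall x, exists n, D 0 x -> D n x /\ ~ D (S n) x).
{ intros x; destruct (least_nat _ (D_void x)) as [n [H1 H2]].
  exists (Nat.pred n); intros D0; destruct n as [|n]; [easy|].
  split; auto; apply NNPP, H2; simpl; lia. }
apply boolp.choice in Hrk; destruct Hrk as [rk Hrk].
(* The new vertex still lies in [D (rk x)], so the depth never drops; [f] is compared at the old
   depth. *)
assert (Hnx : forall x, exists y, D 0 x ->
  adj x y /\ D 0 y /\ rk x <= rk y /\ f (rk x) y < f (rk x) x).
{ intros x; destruct (classic (D 0 x)) as [D0|]; [|exists x; tauto].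
  destruct (Hrk x D0) as [Dx nDx]; destruct (Hf _ x Dx nDx) as [y [xy [Dy fy]]].
  assert (D0y : D 0 y) by (revert Dy; apply nested_le; lia).
  exists y; intros _; repeat split; auto.
  destruct (Nat.le_gt_cases (rk x) (rk y)) as [|L]; auto.
  destruct (Hrk y D0y) as [_ []]; revert Dy; apply nested_le; lia. }
apply boolp.choice in Hnx; destruct Hnx as [nx Hnx].
destruct (D_inh 0) as [x0 Dx0].
set (w := fun k => Nat.iter k nx x0).
assert (w0 : forall k, D 0 (w k)).
{ induction k as [|k IH]; auto; apply (Hnx _ IH). }
assert (wS : forall k, adj (w k) (w (S k)) /\ rk (w k) <= rk (w (S k)) /\
  f (rk (w k)) (w (S k)) < f (rk (w k)) (w k)).
{ intros k; destruct (Hnx _ (w0 k)) as [H1 [_ H2]]; auto. }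
(* A later vertex of equal depth has a strictly smaller [f], which excludes repetitions. *)
assert (wlt : forall d k, rk (w k) <= rk (w (S (d + k))) /\
  (rk (w (S (d + k))) = rk (w k) ->
   f (rk (w k)) (w (S (d + k))) < f (rk (w k)) (w k))).
{ induction d as [|d IH]; intros k.
  - destruct (wS k) as [_ [H1 H2]]; simpl; auto.
  - destruct (IH k) as [H1 H2]; destruct (wS (S (d + k))) as [_ [H3 H4]].
    change (S d + k) with (S (d + k)); split; [lia|intros E].
    assert (E' : rk (w (S (d + k))) = rk (w k)) by lia.
    rewrite E' in H4; specialize (H2 E'); lia. }
assert (winj : forall m n, w m = w n -> m = n).
{ assert (H : forall m n, m < n -> w m <> w n).
  { intros m n L E; destruct (wlt (n - S m) m) as [_ H].
    replace (S (n - S m + m)) with n in H by lia.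
    rewrite <- E in H; specialize (H eq_refl); lia. }
  intros m n E; destruct (Nat.lt_trichotomy m n) as [L|[L|L]]; auto.
  - now apply H in L.
  - symmetry in E; now apply H in L. }
assert (wadj : forall k, adj (w k) (w (S k))) by (intros k; apply wS).
exists (Ray V adj w winj wadj).
(* While the depth stays [n], the value of [f n] drops at each step, so the depth eventually exceeds
   [n]. *)
assert (climb : forall n, exists m, n <= rk (w m)).
{ induction n as [|n [m Hm]]; [exists 0; lia|].
  assert (H : forall k m, f n (w m) <= k -> n <= rk (w m) ->
    exists m', S n <= rk (w m')).
  { induction k as [|k IH]; intros j Hj Rj;
      destruct (Nat.eq_dec (rk (w j)) n) as [E|E]; try (exists j; lia);
      destruct (wS j) as [_ [H1 H2]]; rewrite E in H1, H2; [lia|].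
    apply (IH (S j)); lia. }
  exact (H _ m (le_n _) Hm). }
intros n; destruct (climb n) as [N HN]; exists N; intros m Hm; simpl.
apply nested_le with (rk (w m)); [|now apply Hrk].
destruct (Nat.eq_dec m N) as [->|]; auto.
destruct (wlt (m - S N) N) as [H _].
replace (S (m - S N + N)) with m in H by lia; lia.
Qed.

End NestedSets.

(** * Dominating vertices *)

(** For distinct vertices this amounts to infinitely many edge-disjoint paths between them. Every
    vertex belongs to its own class. *)
Definition inf_connected (v u : V) : Prop := forall F, conn F v u.

Definition dominates (v : V) r : Prop :=
  forall F, exists N, forall m, N <= m -> conn F v (r m).

Lemma dominates_tail v r C :
  region adj C -> C v -> dominates v r -> tail_in r C.
Proof.
intros rC Cv vr; destruct (region_boundary C rC) as [F HF].
destruct (vr F) as [N HN]; exists N; intros m Hm; apply HF with v; auto.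
Qed.

Lemma dominates_mem v r C :
  region adj C -> dominates v r -> tail_in r C -> C v.
Proof.
intros rC vr [M HM]; destruct (region_boundary C rC) as [F HF].
destruct (vr F) as [N HN]; apply HF with (r (N + M)).
- apply conn_sym, HN; lia.
- apply HM; lia.
Qed.

(** If [r] met the class of [v] infinitely often, then for each finite [F] a late visit would join
    [v] to the tail of [r] outside [F]. *)
Lemma undominated_avoids v r :
  ~ dominates v r -> exists N, forall m, N <= m -> ~ inf_connected v (r m).
Proof.
intros nd; apply NNPP; intros H; apply nd; intros F.
destruct (ray_tail_conn r F) as [N HN]; exists N; intros m Hm.
apply NNPP; intros nc; apply H; exists N; intros k Hk vk; apply nc.
apply rt_trans with (r k); auto.
Qed.

(** * Connected sets sending infinitely many edges to the class of a vertex *)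

Section FatSets.
Variable v : V.

(** Fat sets are what could give a component an infinite boundary after the class of [v] is deleted;
    their existence will force [v] to dominate a ray. *)
Definition fat (D : V -> Prop) : Prop :=
  connected_in D /\ (forall x, D x -> ~ inf_connected v x) /\
  ~ finitely_many (fun p => D (fst p) /\ inf_connected v (snd p) /\ adj (fst p) (snd p)).

Lemma fat_inhabited D : fat D -> exists x, D x.
Proof.
intros [_ [_ nf]]; apply NNPP; intros H; apply nf; exists nil.
intros p [Dp _]; apply H; eauto.
Qed.

(* The finitely many vertices of [S] have a neighbourhood [A] with finite boundary
   missing the class of [v]; one of the finitely many components of [D - A] is
   still fat. *)
Lemma fat_shrink D (S : list V) :
  fat D -> exists D' T, fat D' /\ (forall x, D' x -> D x) /\
    (forall x, D' x -> ~ In x S) /\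
    (forall x y, D' x -> D y -> ~ D' y -> adj x y -> In x T).
Proof.
intros fD; destruct (fat_inhabited D fD) as [d Dd].
destruct fD as [cD [DK nf]].
assert (HF : forall x, exists F, D x -> ~ conn F x v).
{ intros x; destruct (classic (D x)) as [Dx|]; [|exists nil; tauto].
  apply NNPP; intros H; apply (DK x Dx); intros F.
  apply NNPP; intros nc; apply H; exists F; intros _ c; now apply nc, conn_sym. }
apply boolp.choice in HF; destruct HF as [Fx HF].
(* Each piece of [A] is cut off from [v] by its own finite set [Fx x]. Including [d] guarantees that
   [A] meets [D]. *)
set (A := fun y => exists x, In x (d :: S) /\ D x /\ conn (Fx x) x y).
assert (AK : forall y, A y -> ~ inf_connected v y).
{ intros y [x [_ [Dx xy]]] vy; apply (HF x Dx).
  apply rt_trans with y; auto; apply conn_sym, vy. }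
assert (SA : forall x, In x (d :: S) -> D x -> A x).
{ intros x Sx Dx; exists x; repeat split; auto; apply rt_refl. }
assert (dA : exists L : list (V * V),
  forall p, A (fst p) /\ ~ A (snd p) /\ adj (fst p) (snd p) -> In p L).
{ assert (H : finitely_many (fun p => exists x, In x (d :: S) /\
    (conn (Fx x) x (fst p) /\ ~ conn (Fx x) x (snd p) /\ adj (fst p) (snd p)))).
  { apply finitely_many_exists_in; intros x _.
    destruct (component_region (Fx x) x) as [_ [_ [l Hl]]]; exists l.
    intros [a b] [H1 [H2 H3]]; auto. }
  revert H; apply finitely_many_sub; intros p [[x [Sx [Dx xp]]] [nA pp]].
  exists x; repeat split; auto; intros c; apply nA; exists x; auto. }
destruct dA as [L HL].
set (Q := fun a b => (D a /\ ~ A a) /\ (D b /\ ~ A b) /\ adj a b).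
assert (Qs : forall a b, Q a b -> Q b a) by (unfold Q; firstorder).
assert (HQ : exists y, D y /\ ~ A y /\ ~ finitely_many (fun p =>
  clos_refl_trans V Q y (fst p) /\ inf_connected v (snd p) /\ adj (fst p) (snd p))).
(* If every component of [D - A] sent finitely many edges to the class, so would [D]. An edge to the
   class from [A] lies in the finite boundary of [A]. Any other starts in a component of [D - A],
   from which a walk to [d] enters [A] through an edge of [L]; so only finitely many components
   matter. *)
{ apply NNPP; intros none; apply nf.
  assert (H : finitely_many (fun p => exists y, In y (List.map snd L) /\
    ((D y /\ ~ A y) /\ clos_refl_trans V Q y (fst p) /\
     inf_connected v (snd p) /\ adj (fst p) (snd p)))).
  { apply finitely_many_exists_in; intros y _.
    destruct (classic (D y /\ ~ A y)) as [[Dy nAy]|H].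
    - apply NNPP; intros nfy; apply none; exists y; repeat split; auto.
      intros H; apply nfy; revert H; apply finitely_many_sub; tauto.
    - exists nil; tauto. }
  assert (HLf : finitely_many (fun p => In p L)) by (exists L; auto).
  generalize (finitely_many_or _ _ HLf H); apply finitely_many_sub.
  intros [x k] [Dx [vk xk]]; simpl in *.
  destruct (classic (A x)) as [Ax|nAx].
  - left; apply HL; repeat split; auto; intros Ak; exact (AK k Ak vk).
  - right; assert (nnAd : ~ ~ A d) by (intros nAd; apply nAd, SA; [now left|auto]).
    destruct (rtc_exit _ (fun y => ~ A y) x d (cD x d Dx Dd) nAx nnAd)
      as [y [a [xy [ya [nAy nnAa]]]]].
    apply NNPP in nnAa; destruct ya as [Dy [Da ya]].
    exists y; split.
    + apply in_map_iff; exists (a, y); split; auto; apply HL; auto.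
    + repeat split; auto; apply rtc_sym; auto; revert xy; apply rtc_mono.
      intros u w [[Du [Dw uw]] [nAu nAw]]; repeat split; auto. }
destruct HQ as [y [Dy [nAy nfy]]].
assert (DQ : forall x, clos_refl_trans V Q y x -> D x /\ ~ A x).
{ intros x yx; apply (rtc_stable Q (fun x => D x /\ ~ A x) y x); auto.
  intros a b [_ [H _]] _; exact H. }
(* An edge from this component to the rest of [D] must lead into [A], so its inner end is the second
   entry of a pair in [L]. *)
exists (clos_refl_trans V Q y), (List.map snd L).
split; [split; [|split]|split; [|split]].
- intros a b ya yb.
  assert (ab : clos_refl_trans V Q a b).
  { apply rt_trans with y; auto; now apply rtc_sym. }
  apply clos_rt_rt1n in ab; induction ab as [|a c b ac _ IH]; [apply rt_refl|].
  assert (yc : clos_refl_trans V Q y c).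
  { apply rt_trans with a; auto; now apply rt_step. }
  apply rt_trans with c; auto; apply rt_step; repeat split; auto; apply ac.
- intros x yx; apply DK, DQ; auto.
- exact nfy.
- intros x yx; now apply DQ.
- intros x yx Sx; destruct (DQ x yx) as [Dx nAx]; apply nAx, SA; auto; now right.
- intros x z yx Dz nz xz; apply in_map_iff; exists (z, x); split; auto.
  apply HL; simpl; destruct (DQ x yx) as [Dx nAx]; repeat split; auto.
  apply NNPP; intros nAz; apply nz; apply rt_trans with x; auto.
  apply rt_step; repeat split; auto.
Qed.

(** Iterated shrinking yields nested fat sets with empty intersection and a ray through them. Each
    fat set still has an edge to the class of [v], which links [v] to the ray outside any given
    finite [F]. *)
Lemma fat_dominates D : fat D -> exists r, dominates v r.
Proof.
intros fD; destruct (fat_inhabited D fD) as [d Dd].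
(* The list holds the vertices that the next fat set must avoid: first [d], afterwards the boundary
   vertices [T] of the current set. *)
set (St := { p : (V -> Prop) * list V | fat (fst p) }).
assert (next : forall s : St, exists s' : St,
  (forall x, fst (proj1_sig s') x -> fst (proj1_sig s) x) /\
  (forall x, fst (proj1_sig s') x -> ~ In x (snd (proj1_sig s))) /\
  (forall x y, fst (proj1_sig s') x -> fst (proj1_sig s) y ->
     ~ fst (proj1_sig s') y -> adj x y -> In x (snd (proj1_sig s')))).
{ intros [[B S] fB]; simpl in *.
  destruct (fat_shrink B S fB) as [B' [T [fB' H]]].
  exists (exist (fun p => fat (fst p)) (B', T) fB'); exact H. }
apply boolp.choice in next; destruct next as [nx Hnx].
set (s0 := exist (fun p => fat (fst p)) (D, [d]) fD : St).
set (s := fun n => Nat.iter n nx s0).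
set (B := fun n => fst (proj1_sig (s n))).
assert (fB : forall n, fat (B n)) by (intros n; exact (proj2_sig (s n))).
assert (Bdecr : forall n x, B (S n) x -> B n x) by (intros n; apply (Hnx (s n))).
(* A walk from a permanent vertex to the discarded [d] has an edge from a permanent [x] to some [y]
   lost at a first stage. Then [x] is listed at that stage and must be dropped at the next one. *)
assert (Bvoid : forall x, exists n, ~ B n x).
{ intros u; apply NNPP; intros H.
  assert (uB : forall n, B n u).
  { intros n; apply NNPP; intros nB; apply H; eauto. }
  assert (nBd : ~ forall n, B n d).
  { intros Bd; destruct (Hnx (s 0)) as [_ [H1 _]]; apply (H1 d (Bd 1)); now left. }
  destruct (rtc_exit _ (fun x => forall n, B n x) u d (proj1 fD u d (uB 0) Dd) uB nBd)
    as [x [y [_ [[_ [Dy xy]] [Bx nBy]]]]].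
  apply not_all_ex_not in nBy; destruct (least_nat _ nBy) as [n [nB Hn]].
  destruct n as [|n]; [now apply nB|].
  assert (Bny : B n y) by (apply NNPP, Hn; lia).
  destruct (Hnx (s n)) as [_ [_ H1]].
  destruct (Hnx (s (S n))) as [_ [H2 _]].
  apply (H2 x (Bx (S (S n)))), (H1 x y); auto; apply (Bx (S n)). }
destruct (nested_ray B Bdecr Bvoid (fun n => proj1 (fB n))
  (fun n => fat_inhabited _ (fB n))) as [r Hr].
exists r; intros F.
destruct (nested_avoids B Bdecr Bvoid (endpoints F)) as [n Hn].
assert (Bk : exists x k, B n x /\ inf_connected v k /\ adj x k).
{ destruct (fB n) as [_ [_ nf]]; apply NNPP; intros H; apply nf; exists nil.
  intros [x k] [Bx Hk]; apply H; exists x, k; auto. }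
destruct Bk as [x [k [Bx [vk xk]]]].
assert (BF : forall a b, B n a -> ~ edge_in F a b).
{ intros a b Ba E; apply (Hn a Ba), (edge_in_endpoints F a b E). }
destruct (Hr n) as [N HN]; exists N; intros m Hm.
(* The connection runs from [v] to [k] in its class, over the edge to [x], and then inside [B n],
   which misses the endpoints of [F]. *)
apply rt_trans with k; [apply vk|].
apply rt_trans with x.
- apply rt_step, adj_minus_sym; split; auto.
- generalize (proj1 (fB n) x (r m) Bx (HN m Hm)); apply rtc_mono.
  intros a b [Ba [Bb ab]]; split; auto.
Qed.

End FatSets.

(** * The refining partitions *)

Section Refinement.
Hypothesis adj_conn : connected_graph adj.
Variable v0 : V.

(** A countable neighbourhood basis at the end of [r]. All late members must lie in [C], because a
    vertex listed late is only cut along late members of its basis. *)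
Definition ray_basis r (E : nat -> V -> Prop) : Prop :=
  (forall n, region adj (E n) /\ tail_in r (E n)) /\
  (forall C, region adj C -> tail_in r C ->
    exists k, forall n, k <= n -> forall r', tail_in r' (E n) -> tail_in r' C).

Definition dominating (v : V) : Prop := exists r, dominates v r.

Variable E : V -> nat -> V -> Prop.
Hypothesis E_basis :
  forall v, dominating v -> exists r, dominates v r /\ ray_basis r (E v).

Variable inner_boundary : (V -> Prop) -> list V.
Hypothesis inner_boundaryP : forall C, region adj C ->
  forall x y, C x -> ~ C y -> adj x y -> In x (inner_boundary C).

Definition kept (v : V) (n : nat) (a b : V) : Prop :=
  (dominating v -> (E v n a <-> E v n b)) /\
  (~ dominating v -> ~ inf_connected v a /\ ~ inf_connected v b).

Lemma kept_sym v n a b : kept v n a b -> kept v n b a.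
Proof. unfold kept; tauto. Qed.

Lemma E_region v n : dominating v -> region adj (E v n) /\ E v n v.
Proof.
intros dv; destruct (E_basis v dv) as [r [vr [H _]]]; destruct (H n) as [rE tE].
split; auto; apply dominates_mem with r; auto.
Qed.

(** A ray crosses the boundary of a region finitely often, and it meets the class of a vertex that
    does not dominate it finitely often. *)
Lemma kept_tail v n r : exists N, forall m, N <= m -> kept v n (r m) (r (S m)).
Proof.
destruct (classic (dominating v)) as [dv|nd].
- destruct (ray_tail_region r (E v n) (proj1 (E_region v n dv))) as [N HN].
  exists N; intros m Hm; split; [|tauto]; intros _.
  split; apply HN; lia.
- destruct (undominated_avoids v r (fun H => nd (ex_intro _ r H))) as [N HN].
  exists N; intros m Hm; split; [tauto|]; intros _; split; apply HN; lia.
Qed.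

(** For a dominating [v] the edges that are not kept lie on the boundary of [E v n]. Otherwise the
    hypothesis on [D] says that it misses the class of [v], and infinitely many edges into that
    class would make [D] fat. *)
Lemma kept_boundary v n D :
  connected_in D -> (forall x, D x -> exists y, kept v n x y) ->
  finitely_many (fun p => D (fst p) /\ adj (fst p) (snd p) /\ ~ kept v n (fst p) (snd p)).
Proof.
intros cD Dk; destruct (classic (dominating v)) as [dv|nd].
- destruct (E_region v n dv) as [[_ [_ [l Hl]]] _].
  exists (List.app l (List.map (fun p => (snd p, fst p)) l)).
  intros [a b] [_ [ab nk]]; simpl in *; apply in_or_app; apply NNPP; intros H.
  apply nk; split; [|tauto]; intros _; split; intros Ea; apply NNPP; intros Eb.
  + apply H; left; auto.
  + apply H; right; apply in_map_iff; exists (b, a); auto.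
- assert (DK : forall x, D x -> ~ inf_connected v x).
  { intros x Dx; destruct (Dk x Dx) as [y [_ H]]; now apply H. }
  assert (H : ~ fat v D) by (intros fD; apply nd; now apply (fat_dominates v D)).
  apply NNPP; intros nf; apply H; split; [|split]; auto.
  intros fK; apply nf; revert fK; apply finitely_many_sub.
  intros [a b] [Da [ab nk]]; simpl in *; repeat split; auto.
  apply NNPP; intros nb; apply nk; split; [tauto|]; auto.
Qed.

Definition state : Type := ((V -> Prop) * list V)%type.

Definition step (s : state) (n : nat) (a b : V) : Prop :=
  fst s a /\ fst s b /\ adj a b /\ forall v, In v (snd s) -> kept v n a b.

Definition with_boundary (s : state) (D : V -> Prop) : state :=
  (D, List.app (inner_boundary D) (snd s)).

(** The witness edge excludes deleted vertices, which are isolated for [step] and would form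
    components of their own. *)
Definition child (s : state) (n : nat) (s' : state) : Prop :=
  exists a b, step s n a b /\
    s' = with_boundary s (clos_refl_trans V (step s n) a).

Lemma step_sym s n a b : step s n a b -> step s n b a.
Proof.
intros [H1 [H2 [H3 H4]]]; do 3 (split; auto); intros; apply kept_sym; auto.
Qed.

Lemma child_step s n s' x :
  child s n s' -> fst s' x -> exists y, step s n x y.
Proof.
intros [a [b [ab ->]]] ax; destruct (rtc_last _ _ _ ax) as [<-|[z zx]]; eauto.
exists z; now apply step_sym.
Qed.

Lemma child_sub s n s' x : child s n s' -> fst s' x -> fst s x.
Proof. intros ch s'x; destruct (child_step _ _ _ _ ch s'x) as [y Hy]; apply Hy. Qed.

Lemma child_rtc s n s' x y :
  child s n s' -> fst s' x -> fst s' y -> clos_refl_trans V (step s n) x y.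
Proof.
intros [a [b [ab ->]]] ax ay; apply rt_trans with a; auto.
apply rtc_sym; auto; intros; now apply step_sym.
Qed.

Lemma child_closed s n s' x y :
  child s n s' -> fst s' x -> clos_refl_trans V (step s n) x y -> fst s' y.
Proof. intros [a [b [ab ->]]] ax xy; now apply rt_trans with x. Qed.

(** A boundary edge of the child either leaves the parent region or is cut by one of the finitely
    many listed vertices. *)
Lemma child_region s n s' : region adj (fst s) -> child s n s' -> region adj (fst s').
Proof.
intros [_ [_ [l Hl]]] ch.
assert (cD : connected_in (fst s')).
{ intros x y Dx Dy; generalize (child_rtc _ _ _ _ _ ch Dx Dy); intros xy.
  apply clos_rt_rt1n in xy; induction xy as [|x z y xz _ IH]; [apply rt_refl|].
  assert (Dz : fst s' z) by (apply (child_closed _ _ _ x z ch); auto; now apply rt_step).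
  apply rt_trans with z; auto; apply rt_step; repeat split; auto; apply xz. }
split; [|split; [exact cD|]].
- destruct ch as [a [b [ab ->]]]; exists a; apply rt_refl.
- assert (H : finitely_many (fun p => exists v, In v (snd s) /\
    (fst s' (fst p) /\ adj (fst p) (snd p) /\ ~ kept v n (fst p) (snd p)))).
  { apply finitely_many_exists_in; intros v Hv; apply kept_boundary; auto.
    intros x Dx; destruct (child_step _ _ _ _ ch Dx) as [y Hy].
    exists y; apply Hy; auto. }
  destruct H as [m Hm]; exists (List.app l m); intros x y Dx nDy xy.
  assert (Cx := child_sub _ _ _ _ ch Dx).
  apply in_or_app; destruct (classic (fst s y)) as [Cy|nCy]; [right|left; auto].
  apply Hm; apply NNPP; intros H; apply nDy.
  apply (child_closed _ _ _ x y ch); auto; apply rt_step; do 3 (split; auto).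
  intros v Hv; apply NNPP; intros nk; apply H; exists v; auto.
Qed.

(** A vertex [v] that dominates no ray would be deleted with its class. Otherwise kept edges do not
    cross the boundary of [E v n], so the child lies on the side of [v]. *)
Lemma child_processed s n s' v :
  child s n s' -> In v (snd s) -> fst s' v ->
  dominating v /\ forall x, fst s' x -> E v n x.
Proof.
intros ch sv Dv; assert (dv : dominating v).
{ apply NNPP; intros nd; destruct (child_step _ _ _ _ ch Dv) as [y [_ [_ [_ H]]]].
  destruct (H v sv) as [_ H']; destruct (H' nd) as [nv _]; apply nv.
  intros F; apply rt_refl. }
split; auto; intros x Dx.
apply (rtc_stable (step s n) (E v n) v x).
- intros a b [_ [_ [_ H]]]; now apply (H v sv).
- now apply (child_rtc s n s').
- now apply E_region.
Qed.

(** The whole vertex set has no boundary; [v0] is listed so that a branch on which [v0] survives has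
    a listed survivor. *)
Definition initial : state := (fun _ => True, [v0]).

Definition branch (s : nat -> state) : Prop :=
  s 0 = initial /\ forall n, child (s n) n (s (S n)).

Lemma initial_region : region adj (fst initial).
Proof.
split; [now exists v0|split].
- intros x y _ _; generalize (adj_conn x y); apply rtc_mono; repeat split; auto.
- exists nil; simpl; tauto.
Qed.

(** * Branches of the recursion and their limits *)

Section Branch.
Variable s : nat -> state.
Hypothesis Hs : branch s.

Lemma branch_region n : region adj (fst (s n)).
Proof.
induction n as [|n IH].
- rewrite (proj1 Hs); apply initial_region.
- apply (child_region _ n _ IH), Hs.
Qed.

Lemma branch_decr n x : fst (s (S n)) x -> fst (s n) x.
Proof. apply child_sub with n, Hs. Qed.

Lemma branch_list_mono m n x : m <= n -> In x (snd (s m)) -> In x (snd (s n)).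
Proof.
induction 1 as [|n _ IH]; auto; intros Hx.
destruct (proj2 Hs n) as [a [b [_ ->]]]; apply in_or_app; auto.
Qed.

Lemma branch_boundary n x y :
  fst (s n) x -> ~ fst (s n) y -> adj x y -> In x (snd (s n)).
Proof.
intros Cx nCy xy; assert (rC := branch_region n); destruct n as [|n].
- destruct nCy; rewrite (proj1 Hs); exact I.
- destruct (proj2 Hs n) as [a [b [_ En]]]; rewrite En in *.
  apply in_or_app; left; now apply inner_boundaryP with y.
Qed.

(** If [v0] is lost, a walk from a survivor to [v0] leaves the set of survivors along an edge. Its
    outer end is missing at some depth, where its inner end is therefore a listed boundary
    vertex. *)
Lemma branch_core :
  (exists u, forall n, fst (s n) u) ->
  exists x m, In x (snd (s m)) /\ forall n, fst (s n) x.
Proof.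
intros [u Hu]; destruct (classic (forall n, fst (s n) v0)) as [H0|H0].
- exists v0, 0; split; auto; rewrite (proj1 Hs); now left.
- destruct (rtc_exit adj (fun x => forall n, fst (s n) x) u v0 (adj_conn u v0) Hu H0)
    as [x [y [_ [xy [Cx nCy]]]]].
  apply not_all_ex_not in nCy; destruct nCy as [m Hm].
  exists x, m; split; auto; apply branch_boundary with y; auto.
Qed.

(** From depth [m] on, [x] is processed at every step, which confines the next region to [E x n].
    The end of [r] stays in all regions because [x] dominates it. *)
Lemma branch_shrinks_to_dominated x m :
  In x (snd (s m)) -> (forall n, fst (s n) x) ->
  exists r, (forall n, tail_in r (fst (s n))) /\
    forall U, region adj U -> tail_in r U ->
      exists n, forall r', tail_in r' (fst (s n)) -> tail_in r' U.
Proof.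
intros lx Cx.
assert (H : forall n, m <= n -> dominating x /\ forall y, fst (s (S n)) y -> E x n y).
{ intros n Hn; apply (child_processed (s n)); auto; [apply Hs|].
  now apply branch_list_mono with m. }
destruct (H m (le_n m)) as [dx _].
destruct (E_basis x dx) as [r [xr [_ Hr]]]; exists r; split.
- intros n; apply dominates_tail with x; auto; apply branch_region.
- intros U rU tU; destruct (Hr U rU tU) as [k Hk].
  exists (S (m + k)); intros r' [N HN]; apply (Hk (m + k)); [lia|].
  exists N; intros j Hj; apply H; auto; lia.
Qed.

Lemma branch_limit :
  exists r, (forall n, tail_in r (fst (s n))) /\
    forall U, region adj U -> tail_in r U ->
      exists n, forall r', tail_in r' (fst (s n)) -> tail_in r' U.
Proof.
destruct (classic (exists u, forall n, fst (s n) u)) as [Hu|Hu].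
- destruct (branch_core Hu) as [x [m [lx Cx]]].
  now apply branch_shrinks_to_dominated with x m.
- assert (void : forall x, exists n, ~ fst (s n) x).
  { intros x; apply not_all_ex_not; intros H; apply Hu; eauto. }
  destruct (nested_ray (fun n => fst (s n)) branch_decr void
    (fun n => proj1 (proj2 (branch_region n))) (fun n => proj1 (branch_region n)))
    as [r Hr].
  exists r; split; auto; intros U rU [N HN].
  destruct (region_boundary U rU) as [F HF].
  (* A late region misses the endpoints of the boundary of [U], is connected and meets [U], so it
     lies inside [U]. *)
  destruct (nested_avoids _ branch_decr void (endpoints F)) as [n Hn].
  exists n; intros r' [N' HN']; exists N'; intros j Hj.
  apply (connected_in_absorbed U (fst (s n)) F); auto.
  + exact (proj1 (proj2 (branch_region n))).
  + intros a b Ca Fab; apply (Hn a Ca); now apply edge_in_endpoints with b.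
  + destruct (Hr n) as [M HM]; exists (r (N + M)); split; [apply HN|apply HM]; lia.
Qed.

(** Any neighbourhood of the limit contains a late region of the branch, hence a tail of [r]; so [r]
    is equivalent to the limit ray. *)
Lemma branch_basis r :
  (forall n, tail_in r (fst (s n))) ->
  forall U, region adj U -> tail_in r U ->
    exists n, forall r', tail_in r' (fst (s n)) -> tail_in r' U.
Proof.
intros Hr; destruct branch_limit as [q [Hq Bq]].
assert (qr : edge_equiv adj q r).
{ apply edge_equiv_of_tails; intros C rC tC.
  destruct (Bq C rC tC) as [n Hn]; auto. }
intros U rU tU; apply Bq; auto.
apply edge_equiv_tail with r; auto; now apply edge_equiv_sym.
Qed.

End Branch.

(** Quantifying over all late vertices of [r] names the component of its tail without choosing a
    starting vertex. *)
Definition next (s : state) (n : nat) (r : ray adj) : state :=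
  with_boundary s
    (fun x => exists N, forall m, N <= m -> clos_refl_trans V (step s n) (r m) x).

Fixpoint part (r : ray adj) (n : nat) : state :=
  match n with
  | 0 => initial
  | S n => next (part r n) n r
  end.

Lemma next_child s n r :
  tail_in r (fst s) -> child s n (next s n r) /\ tail_in r (fst (next s n r)).
Proof.
intros [N HN].
assert (K : exists M, forall m, M <= m ->
  forall v, In v (snd s) -> kept v n (r m) (r (S m))).
{ induction (snd s) as [|v l [M HM]]; [exists 0; simpl; tauto|].
  destruct (kept_tail v n r) as [M' HM']; exists (M + M').
  intros m Hm w [<-|Hw]; [apply HM'; lia|apply HM; auto; lia]. }
destruct K as [M HM].
assert (st : forall m, N + M <= m -> step s n (r m) (r (S m))).
{ intros m Hm; split; [apply HN; lia|split; [apply HN; lia|]].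
  split; [apply ray_adj|apply HM; lia]. }
assert (tl := ray_tail_rtc (step s n) r (N + M) (step_sym s n) st).
split.
- exists (r (N + M)), (r (S (N + M))); split; [apply st; lia|].
  unfold next; f_equal; apply predeqP; intros x; split.
  + intros [P HP]; apply rt_trans with (r (N + M + P)); [apply tl; lia|apply HP; lia].
  + intros Hx; exists (N + M); intros m Hm.
    apply rt_trans with (r (N + M)); auto.
- exists (N + M); intros m Hm; exists (N + M); intros k Hk; auto.
Qed.

Lemma part_tail r n : tail_in r (fst (part r n)).
Proof.
induction n as [|n IH]; [exists 0; simpl; auto|now apply next_child].
Qed.

Lemma part_branch r : branch (part r).
Proof. split; auto; intros n; apply next_child, part_tail. Qed.

(** Inductively the predecessors agree as states, lists included, so both parts are the component of
    [x] for one and the same relation. *)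
Lemma part_meet r r' n x :
  fst (part r n) x -> fst (part r' n) x -> part r n = part r' n.
Proof.
revert x; induction n as [|n IH]; auto; intros x Cx Cx'.
assert (ch := proj2 (part_branch r) n); assert (ch' := proj2 (part_branch r') n).
assert (En : part r n = part r' n).
{ apply IH with x; eapply child_sub; eassumption. }
rewrite En in ch; cbn [part] in *; rewrite En in *.
enough (fst (next (part r' n) n r) = fst (next (part r' n) n r')) as H.
{ unfold next, with_boundary in *; cbn [fst] in H; now rewrite H. }
apply predeqP; intros y; split; intros Hy.
- apply (child_closed _ _ _ x y ch'); auto; now apply (child_rtc _ _ _ x y ch).
- apply (child_closed _ _ _ x y ch); auto; now apply (child_rtc _ _ _ x y ch').
Qed.

Definition same_part (n : nat) (r r' : ray adj) : Prop := part r n = part r' n.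

Lemma same_partP n r r' : same_part n r r' <-> tail_in r' (fst (part r n)).
Proof.
split; [intros H; rewrite H; apply part_tail|].
intros [N HN]; destruct (part_tail r' n) as [M HM].
apply part_meet with (r' (N + M)); [apply HN|apply HM]; lia.
Qed.

Lemma same_part_decr n r r' : same_part (S n) r r' -> same_part n r r'.
Proof.
intros H; apply same_partP in H; apply same_partP; destruct H as [N HN].
exists N; intros m Hm; apply branch_decr; auto; apply part_branch.
Qed.

(** The parts of the changing rays [q n] still form one branch, whose limit ray is the required
    [r]. *)
Lemma same_part_complete (q : nat -> ray adj) :
  (forall n, same_part n (q n) (q (S n))) ->
  exists r, forall n, same_part n r (q n).
Proof.
intros Hq.
assert (Hb : branch (fun n => part (q n) n)).
{ split; auto; intros n; rewrite (Hq n); apply part_branch. }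
destruct (branch_limit _ Hb) as [r [Hr _]]; exists r; intros n.
symmetry; apply same_partP, Hr.
Qed.

End Refinement.
End Graph.

(** * Edge-ends *)

Section Ends.
Context {V : Type} {adj : V -> V -> Prop}.
Hypothesis adj_sym : forall x y, adj x y -> adj y x.
Implicit Types (r : ray adj) (w : edge_end adj).

Lemma edge_equiv_refl r : edge_equiv adj r r.
Proof. intros F; apply ray_tail_conn, adj_sym. Qed.

Definition end_of r : edge_end adj :=
  exist _ (edge_equiv adj r) (ex_intro _ r (fun r' => iff_refl _)).

Lemma end_of_mem r : proj1_sig (end_of r) r.
Proof. apply edge_equiv_refl. Qed.

Lemma end_mem_equiv w r r' :
  proj1_sig w r -> (proj1_sig w r' <-> edge_equiv adj r r').
Proof.
destruct w as [P [q Hq]]; simpl; intros Pr; apply Hq in Pr; split.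
- intros Pr'; apply Hq in Pr'.
  apply edge_equiv_trans with q; auto; apply edge_equiv_sym; auto.
- intros rr'; apply Hq, edge_equiv_trans with r; auto.
Qed.

Lemma end_has_ray w : exists r, proj1_sig w r.
Proof.
destruct w as [P [q Hq]]; exists q; apply Hq, edge_equiv_refl.
Qed.

Lemma end_eq w w' r r' :
  proj1_sig w r -> proj1_sig w' r' -> edge_equiv adj r r' -> w = w'.
Proof.
intros wr wr' rr'.
assert (H : proj1_sig w = proj1_sig w').
{ apply predeqP; intros q.
  rewrite (end_mem_equiv w r q wr), (end_mem_equiv w' r' q wr').
  split; apply edge_equiv_trans; auto; apply edge_equiv_sym; auto. }
destruct w as [P HP], w' as [P' HP']; simpl in H; subst P'.
f_equal; apply proof_irrelevance.
Qed.

(** Equivalent rays have tails in the same regions, so one representative decides; shifting it moves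
    it entirely into [C]. *)
Lemma end_in_regionP w r C :
  region adj C -> proj1_sig w r -> (end_in_region adj C w <-> tail_in r C).
Proof.
intros rC wr; split.
- intros [q [wq Cq]]; apply edge_equiv_tail with q; auto.
  + now apply (end_mem_equiv w).
  + exists 0; auto.
- intros [N HN]; exists (shift_ray r N); split.
  + apply (end_mem_equiv w r); auto; apply edge_equiv_shift; auto.
  + intros n; apply HN; simpl; lia.
Qed.

End Ends.

(** * Ladders of clopen partitions *)

Lemma open_local {X : topologicalType} (U : set X) :
  (forall x, U x -> exists W : set X, open W /\ W x /\ forall y, W y -> U y) -> open U.
Proof.
intros H; rewrite openE; intros x Ux.
destruct (H x Ux) as [W [oW [Wx WU]]].
apply (filterS WU), open_nbhs_nbhs; split; auto.
Qed.

(* A sequence of partitions of [X] presenting [X] as a complete ultrametric space: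
   [R n x] is the closed ball around [x] of radius 2^-(n+1). *)
Record ladder (X : topologicalType) (R : nat -> X -> X -> Prop) : Prop := {
  ladder_refl : forall n x, R n x x;
  ladder_sym : forall n x y, R n x y -> R n y x;
  ladder_trans : forall n x y z, R n x y -> R n y z -> R n x z;
  ladder_total : forall x y, R 0 x y;
  ladder_decr : forall n x y, R (S n) x y -> R n x y;
  ladder_open : forall n x, open (R n x : set X);
  ladder_basis : forall x (U : set X), open U -> U x ->
    exists n, forall y, R n x y -> U y;
  ladder_sep : forall x y, (forall n, R n x y) -> x = y;
  ladder_complete : forall u : nat -> X, (forall n, R n (u n) (u (S n))) ->
    exists x, forall n, R n x (u n) }.

(** * A ladder on a first countable edge-end space *)

Section FromGraph.
Context {X : topologicalType} {V : Type} {adj : V -> V -> Prop}.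
Hypothesis adj_sym : forall x y, adj x y -> adj y x.
Hypothesis adj_conn : connected_graph adj.
Variable f : X -> edge_end adj.
Hypothesis f_inj : forall x y, f x = f y -> x = y.
Hypothesis f_surj : forall w, exists x, f x = w.
Hypothesis f_open : forall U : set X, open U <-> end_open adj (image U f).

Lemma open_iff_regions (U : set X) :
  open U <-> forall x, U x -> exists C, region adj C /\ end_in_region adj C (f x) /\
    forall y, end_in_region adj C (f y) -> U y.
Proof.
rewrite f_open; split.
- intros H x Ux; destruct (H (f x)) as [C [rC [Cx CU]]]; [now exists x|].
  exists C; split; auto; split; auto; intros y Cy.
  destruct (CU _ Cy) as [z Uz E]; apply f_inj in E; now subst z.
- intros H w [x Ux <-]; destruct (H x Ux) as [C [rC [Cx CU]]].
  exists C; split; auto; split; auto; intros w Cw.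
  destruct (f_surj w) as [y <-]; exists y; auto.
Qed.

Lemma open_region_ends C :
  region adj C -> open ((fun x => end_in_region adj C (f x)) : set X).
Proof.
intros rC; apply open_iff_regions; intros x Cx; exists C; auto.
Qed.

Lemma first_countable_ray_basis (r : ray adj) :
  first_countable X -> exists E, ray_basis r E.
Proof.
intros fc; destruct (f_surj (end_of r)) as [x Ex].
assert (xr : proj1_sig (f x) r) by (rewrite Ex; now apply end_of_mem).
destruct (fc x) as [B [HB Bb]].
(* The given basis need not decrease; finite intersections make all late members small, as
   [ray_basis] demands. *)
assert (HI : forall n, exists W : set X, open W /\ W x /\
  forall k, k <= n -> forall y, W y -> B k y).
{ induction n as [|n [W [oW [Wx WB]]]].
  - exists (B 0); repeat split; try apply HB; intros k Hk.
    replace k with 0 by lia; auto.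
  - exists (setI W (B (S n))); split; [apply openI; auto; apply HB|split].
    + split; auto; apply HB.
    + intros k Hk y [Wy By]; destruct (Nat.eq_dec k (S n)) as [->|]; auto.
      apply WB; auto; lia. }
assert (HE : forall n, exists C, region adj C /\ end_in_region adj C (f x) /\
  forall k, k <= n -> forall y, end_in_region adj C (f y) -> B k y).
{ intros n; destruct (HI n) as [W [oW [Wx WB]]].
  destruct (proj1 (open_iff_regions W) oW x Wx) as [C [rC [Cx CW]]].
  exists C; split; auto; split; auto; intros k Hk y Cy; apply (WB k); auto. }
apply boolp.choice in HE; destruct HE as [E HE]; exists E; split.
- intros n; destruct (HE n) as [rE [Ex' _]]; split; auto.
  now apply (end_in_regionP adj_sym (f x)).
- intros C rC tC.
  destruct (Bb _ (open_region_ends C rC)) as [k Hk].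
  { now apply (end_in_regionP adj_sym (f x) r). }
  exists k; intros n Hn r' tr'; destruct (f_surj (end_of r')) as [y Ey].
  assert (yr : proj1_sig (f y) r') by (rewrite Ey; now apply end_of_mem).
  apply (end_in_regionP adj_sym (f y)); auto; apply Hk.
  destruct (HE n) as [rE [_ H]]; apply (H k Hn).
  now apply (end_in_regionP adj_sym (f y) r').
Qed.

Lemma ladder_of_first_countable :
  first_countable X -> exists R, ladder X R.
Proof.
intros fc; destruct (classic (inhabited V)) as [[v0]|nV].
(* Without vertices there are no rays, so [X] is empty and any relation is a ladder. *)
2:{ assert (nX : X -> False).
    { intros x; destruct (end_has_ray adj_sym (f x)) as [r _]; apply nV.
      exact (inhabits (r 0)). }
    exists (fun _ _ _ => True); split; auto; try (intros; exfalso; auto; fail).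
    intros u; destruct (nX (u 0)). }
assert (HE : forall v, exists E, dominating (adj := adj) v ->
  exists r : ray adj, dominates v r /\ ray_basis r E).
{ intros v; destruct (classic (dominating (adj := adj) v)) as [[r vr]|nd].
  - destruct (first_countable_ray_basis r fc) as [E HE]; exists E; intros _.
    exists r; auto.
  - exists (fun _ _ => True); tauto. }
apply boolp.choice in HE; destruct HE as [E HE].
assert (HB : forall C, exists l : list V, region adj C ->
  forall x y, C x -> ~ C y -> adj x y -> In x l).
{ intros C; destruct (classic (region adj C)) as [rC|]; [|exists nil; tauto].
  destruct rC as [_ [_ [l Hl]]]; exists (List.map fst l); intros _ x y Cx Cy xy.
  apply in_map_iff; exists (x, y); auto. }
apply boolp.choice in HB; destruct HB as [bd Hbd].
assert (Hrho : forall x, exists r, proj1_sig (f x) r).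
{ intros x; now apply end_has_ray. }
apply boolp.choice in Hrho; destruct Hrho as [rho Hrho].
set (P := part (adj := adj) v0 E bd).
assert (Pbranch : forall r, branch (adj := adj) v0 E bd (P r)).
{ intros r; apply part_branch; auto. }
assert (Preg : forall r n, region adj (fst (P r n))).
{ intros r n; apply (branch_region adj_sym adj_conn v0 E HE bd); auto. }
assert (Ptail : forall r n r',
  P r n = P r' n <-> tail_in r' (fst (P r n))).
{ intros r n r'; apply (same_partP adj_sym v0 E HE bd). }
(* Two points are related at depth [n] when their chosen rays end in the same part. *)
exists (fun n x y => P (rho x) n = P (rho y) n); split; auto.
- intros n x y z -> ->; auto.
- intros n x y; apply (same_part_decr adj_sym v0 E HE bd).
- intros n x; apply open_iff_regions; intros y xy.
  exists (fst (P (rho y) n)); split; auto; split.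
  + apply (end_in_regionP adj_sym (f y) (rho y)); auto; now apply Ptail.
  + intros z Cz; apply (end_in_regionP adj_sym (f z) (rho z)) in Cz; auto.
    apply Ptail in Cz; congruence.
- intros x U oU Ux; destruct (proj1 (open_iff_regions U) oU x Ux) as [C [rC [Cx CU]]].
  apply (end_in_regionP adj_sym (f x) (rho x)) in Cx; auto.
  destruct (branch_basis adj_sym adj_conn v0 E HE bd Hbd _ (Pbranch (rho x)) (rho x)
    (fun n => proj1 (Ptail _ n _) eq_refl) C rC Cx) as [n Hn].
  exists n; intros y xy; apply CU, (end_in_regionP adj_sym (f y) (rho y)); auto.
  now apply Hn, Ptail.
- intros x y xy; apply f_inj, (end_eq adj_sym (f x) (f y) (rho x) (rho y)); auto.
  apply edge_equiv_of_tails; auto; intros C rC tC.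
  destruct (branch_basis adj_sym adj_conn v0 E HE bd Hbd _ (Pbranch (rho x)) (rho x)
    (fun n => proj1 (Ptail _ n _) eq_refl) C rC tC) as [n Hn].
  now apply Hn, Ptail.
- intros u Hu.
  destruct (same_part_complete adj_sym adj_conn v0 E HE bd Hbd (fun n => rho (u n)) Hu)
    as [r Hr].
  destruct (f_surj (end_of r)) as [x Ex]; exists x; intros n.
  assert (xr : proj1_sig (f x) r) by (rewrite Ex; now apply end_of_mem).
  transitivity (P r n); [symmetry|apply Hr].
  apply Ptail, edge_equiv_tail with r; auto; [|now apply Ptail].
  now apply (end_mem_equiv adj_sym (f x)).
Qed.

End FromGraph.

(** * Metrics *)

Section Metrics.
Local Open Scope R_scope.

Lemma half_pow_pos n : 0 < (/ 2) ^ n.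
Proof. apply pow_lt; lra. Qed.

Lemma half_pow_lt m n : (m < n)%nat -> (/ 2) ^ n < (/ 2) ^ m.
Proof.
induction 1 as [|n _ IH]; simpl.
- generalize (half_pow_pos m); lra.
- generalize (half_pow_pos n); lra.
Qed.

Lemma half_pow_small (e : R) : 0 < e -> exists n, (/ 2) ^ n < e.
Proof.
intros He; destruct (pow_lt_1_zero (/ 2)) with (y := e) as [N HN]; auto.
{ rewrite Rabs_right; lra. }
exists N; generalize (HN N (le_n N)); rewrite Rabs_right; auto.
left; apply half_pow_pos.
Qed.

Lemma metrizable_first_countable (X : topologicalType) :
  metrizable X -> first_countable X.
Proof.
intros [d [[d0 [dE [ds dt]]] dX]] x.
exists (fun n y => d x y < (/ 2) ^ n); split.
- intros n; split.
  + apply dX; intros y Hy; exists ((/ 2) ^ n - d x y); split; [lra|].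
    intros z Hz; generalize (dt x y z); lra.
  + rewrite (proj2 (dE x x) eq_refl); apply half_pow_pos.
- intros U oU Ux; destruct (proj1 (dX U) oU x Ux) as [e [He HU]].
  destruct (half_pow_small e He) as [n Hn]; exists n; intros y Hy; apply HU.
  simpl in Hy; lra.
Qed.

(** Distinct points have distance 2^-n for the first [n] at which [R n] separates them. The listed
    values and the description of balls suffice for the metric axioms. *)
Lemma ladder_ultrametric (X : topologicalType) (R : nat -> X -> X -> Prop) :
  ladder X R ->
  exists d : X -> X -> Rdefinitions.R,
    (forall x y, d x y = 0 \/ exists n, d x y = (/ 2) ^ n) /\
    (forall x, d x x = 0) /\
    (forall n x y, d x y < (/ 2) ^ n <-> R n x y).
Proof.
intros L.
assert (H : forall p : X * X, exists n, fst p <> snd p ->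
  ~ R n (fst p) (snd p) /\ forall m, (m < n)%nat -> R m (fst p) (snd p)).
{ intros [x y]; simpl; destruct (classic (x = y)) as [|xy]; [exists 0%nat; tauto|].
  destruct (least_nat (fun n => ~ R n x y)) as [n [nR Hn]].
  - apply not_all_ex_not; intros H; apply xy; now apply (ladder_sep X R L).
  - exists n; intros _; split; auto; intros m Hm; apply NNPP, Hn, Hm. }
apply boolp.choice in H; destruct H as [lv Hlv].
assert (mono : forall m n x y, (m <= n)%nat -> R n x y -> R m x y).
{ induction 1; auto; intros; apply IHle, (ladder_decr X R L); auto. }
exists (fun x y => if excluded_middle_informative (x = y) then 0 else (/ 2) ^ lv (x, y)).
split; [|split].
- intros x y; destruct (excluded_middle_informative _); eauto.
- intros x; now destruct (excluded_middle_informative _).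
- intros n x y; destruct (excluded_middle_informative _) as [<-|xy].
  { split; intros _; [apply (ladder_refl X R L)|apply half_pow_pos]. }
  destruct (Hlv (x, y) xy) as [nR HR]; simpl in nR, HR; split.
  + intros Hlt; apply HR; apply NNPP; intros Hle; apply Nat.nlt_ge in Hle.
    destruct (proj1 (Nat.lt_eq_cases _ _) Hle) as [Hl|Hl].
    * apply half_pow_lt in Hl; lra.
    * rewrite Hl in Hlt; lra.
  + intros Rn; apply half_pow_lt; apply NNPP; intros Hle; apply Nat.nlt_ge in Hle.
    apply nR; revert Rn; now apply mono.
Qed.

Lemma ladder_completely_ultrametrizable
  (X : topologicalType) (R : nat -> X -> X -> Prop) :
  ladder X R -> completely_ultrametrizable X.
Proof.
intros L; destruct (ladder_ultrametric X R L) as [d [dv [dxx dR]]].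
assert (d0 : forall x y, 0 <= d x y).
{ intros x y; destruct (dv x y) as [->|[n ->]]; [lra|left; apply half_pow_pos]. }
assert (du : is_ultrametric d).
{ intros x y z; destruct (dv x z) as [E|[n E]].
  - rewrite E; apply Rle_trans with (d x y); [apply d0|apply Rmax_l].
  (* If both distances on the right were below [d x z], a power of 1/2, transitivity at that depth
     would put [d x z] below itself. *)
  - apply Rnot_lt_le; intros H; apply (Rlt_irrefl (d x z)).
    rewrite E at 2; apply dR; rewrite E in H.
    apply (ladder_trans X R L) with y; apply dR; apply Rle_lt_trans with (2 := H);
      [apply Rmax_l|apply Rmax_r]. }
assert (ds : forall x y, d x y <= d y x).
{ intros x y; destruct (dv x y) as [E|[n E]]; [rewrite E; apply d0|].
  apply Rnot_lt_le; intros H; apply (Rlt_irrefl (d x y)); rewrite E at 2.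
  apply dR, (ladder_sym X R L), dR; now rewrite <- E. }
exists d; split; [|split; [exact du|split]].
- split; [exact d0|split; [|split]].
  + intros x y; split; [|intros ->; apply dxx]; intros E.
    apply (ladder_sep X R L); intros n; apply dR; rewrite E; apply half_pow_pos.
  + intros x y; apply Rle_antisym; apply ds.
  + intros x y z; apply Rle_trans with (1 := du x y z); apply Rmax_lub;
      generalize (d0 x y) (d0 y z); lra.
- intros U; split.
  + intros oU x Ux; destruct (ladder_basis X R L x U oU Ux) as [n Hn].
    exists ((/ 2) ^ n); split; [apply half_pow_pos|]; intros y Hy; now apply Hn, dR.
  + intros H; apply open_local; intros x Ux; destruct (H x Ux) as [e [He HU]].
    destruct (half_pow_small e He) as [n Hn].
    exists (R n x); split; [apply (ladder_open X R L)|split].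
    * apply (ladder_refl X R L).
    * intros y Hy; apply HU; apply dR in Hy; lra.
- intros u Hu.
  assert (HM : forall n, exists M, forall i j, (M <= i)%nat -> (M <= j)%nat ->
    R n (u i) (u j)).
  { intros n; destruct (Hu _ (half_pow_pos n)) as [M HM]; exists M.
    intros i j Hi Hj; apply dR; auto. }
  apply boolp.choice in HM; destruct HM as [M HM].
  destruct (ladder_complete X R L (fun n => u (M n))) as [l Hl].
  (* Consecutive terms of the subsequence are compared through an index beyond both bounds. *)
  { intros n; apply (ladder_trans X R L) with (u (M n + M (S n))%nat).
    - apply HM; lia.
    - apply (ladder_decr X R L), HM; lia. }
  exists l; intros e He; destruct (half_pow_small e He) as [n Hn].
  exists (M n); intros i Hi; apply Rlt_trans with (2 := Hn), dR.
  apply (ladder_trans X R L) with (u (M n)); [apply HM; auto; lia|].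
  apply (ladder_sym X R L), Hl.
Qed.

End Metrics.

(** * Trees *)

Section TreeEnds.
Context {V : Type} {adj : V -> V -> Prop}.
Hypothesis adj_tree : is_tree adj.

Local Notation conn F := (clos_refl_trans V (adj_minus adj F)).

(** A shortest walk from [a] to [b] that avoids the edge repeats no vertex and closes up with the
    edge to a cycle. *)
Lemma tree_edge_bridge a b : adj a b -> ~ conn [(a, b)] a b.
Proof.
destruct adj_tree as [[adj_sym adj_irr] [_ acy]]; intros ab cab.
destruct (distance_exists (adj_minus adj [(a, b)]) (eq b)) as [f Hf].
set (Re := reaches (adj_minus adj [(a, b)]) (eq b)).
assert (Hnx : forall x, exists y, Re x -> f x <> 0 ->
  adj_minus adj [(a, b)] x y /\ Re y /\ f x = S (f y)).
{ intros x; destruct (classic (Re x /\ f x <> 0)) as [[Hx fx]|H].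
  - destruct (proj2 (Hf x Hx) fx) as [y Hy]; exists y; auto.
  - exists x; tauto. }
apply boolp.choice in Hnx; destruct Hnx as [nx Hnx].
set (c := fun i => Nat.iter i nx a).
assert (Hc : forall i, i <= f a -> Re (c i) /\ f (c i) + i = f a).
{ induction i as [|i IH]; intros Hi; [split; [exists b; auto|simpl; lia]|].
  destruct IH as [H1 H2]; [lia|].
  destruct (Hnx (c i) H1) as [_ [H3 H4]]; [lia|].
  change (c (S i)) with (nx (c i)); split; auto; lia. }
assert (cS : forall i, i < f a -> adj_minus adj [(a, b)] (c i) (c (S i))).
{ intros i Hi; destruct (Hc i) as [H1 H2]; [lia|]; apply (Hnx (c i) H1); lia. }
assert (cb : c (f a) = b).
{ destruct (Hc (f a)) as [H1 H2]; [lia|]; symmetry; apply (Hf _ H1); lia. }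
apply (acy (S (f a)) c).
(* Length 0 would give a loop, and length 1 would use the deleted edge. *)
- destruct (f a) as [|[|k]]; [| |lia].
  + change (c 0) with a in cb; subst b; now apply adj_irr in ab.
  + destruct (cS 0) as [_ []]; [lia|]; rewrite cb; left; now left.
- intros i j Hi Hj Eij; destruct (Hc i) as [_ H1]; [lia|].
  destruct (Hc j) as [_ H2]; [lia|]; rewrite Eij in H1; lia.
- intros i Hi; apply cS; lia.
- simpl; rewrite cb; now apply adj_sym.
Qed.

Definition beyond (r : ray adj) (n : nat) : V -> Prop := conn [(r n, r (S n))] (r (S n)).

Lemma ray_avoids_edge (r : ray adj) n m :
  m <> n -> adj_minus adj [(r n, r (S n))] (r m) (r (S m)).
Proof.
intros mn; split; [apply ray_adj|].
intros [[E|[]]|[E|[]]]; injection E; intros E1 E2; apply ray_inj in E1, E2; lia.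
Qed.

(** A fixed walk from [u] to [r 0] avoids all late edges of [r]. A vertex beyond such an edge would
    connect its two ends without it. *)
Lemma beyond_void (r : ray adj) (u : V) : exists N, forall n, N <= n -> ~ beyond r n u.
Proof.
destruct adj_tree as [[adj_sym _] [adj_conn _]].
destruct (rtc_finite_support _ _ _ (adj_conn u (r 0))) as [l Hl].
destruct (ray_leaves r l) as [N HN]; exists N; intros n Hn bu.
apply (tree_edge_bridge (r n) (r (S n))); [apply ray_adj|].
set (F := [(r n, r (S n))]).
apply rt_trans with u.
- apply rt_trans with (r 0).
  + apply conn_sym; auto.
    assert (H : forall m, m <= n -> conn F (r 0) (r m)); [|now apply H].
    induction m as [|m IH]; intros Hm; [apply rt_refl|].
    apply rt_trans with (r m); [apply IH; lia|].
    apply rt_step, ray_avoids_edge; lia.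
  + apply conn_sym; auto; revert Hl; apply rtc_mono.
    intros a b [ab la]; split; auto; intros [[E|[]]|[E|[]]]; injection E; intros _ E1.
    * apply (HN n Hn); now rewrite E1.
    * apply (HN (S n)); [lia|]; congruence.
- now apply conn_sym.
Qed.

Lemma beyond_avoids (r : ray adj) (l : list V) :
  exists N, forall n, N <= n -> forall x, beyond r n x -> ~ In x l.
Proof.
induction l as [|v l [N HN]]; [exists 0; auto|].
destruct (beyond_void r v) as [M HM]; exists (N + M); intros n Hn x bx [<-|xl].
- apply (HM n); auto; lia.
- apply (HN n) with x; auto; lia.
Qed.

(** The components beyond the successive edges of a ray form a neighbourhood basis at its end, since
    late ones miss any finite set of vertices. *)
Lemma tree_first_countable (X : topologicalType) :
  homeomorphic_to_ends X adj -> first_countable X.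
Proof.
destruct adj_tree as [[adj_sym _] _].
intros [f [[g gf fg] fo]] x.
assert (f_inj : forall x y, f x = f y -> x = y).
{ intros a b E; rewrite <- (gf a), E; apply gf. }
assert (f_surj : forall w, exists x, f x = w) by (intros w; exists (g w); apply fg).
destruct (end_has_ray adj_sym (f x)) as [r xr].
assert (br : forall n, region adj (beyond r n)).
{ intros n; apply component_region, adj_sym. }
assert (bt : forall n m, S n <= m -> beyond r n (r m)).
{ intros n m Hm; apply (ray_tail_rtc (adj_minus adj [(r n, r (S n))]) r (S n)); auto.
  - intros a b; apply adj_minus_sym, adj_sym.
  - intros k Hk; apply ray_avoids_edge; lia. }
exists (fun n y => end_in_region adj (beyond r n) (f y)); split.
- intros n; split; [now apply open_region_ends|].
  apply (end_in_regionP adj_sym (f x) r); auto; exists (S n); auto.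
- intros U oU Ux.
  destruct (proj1 (open_iff_regions f f_inj f_surj fo U) oU x Ux) as [C [rC [Cx CU]]].
  apply (end_in_regionP adj_sym (f x) r) in Cx; auto; destruct Cx as [M HM].
  destruct (region_boundary C rC) as [F HF].
  destruct (beyond_avoids r (endpoints F)) as [N HN].
  exists N; intros y [q [yq Cq]]; apply CU; exists q; split; auto; intros k.
  apply (connected_in_absorbed (adj := adj) C (beyond r N) F); auto.
  + exact (proj1 (proj2 (br N))).
  + intros a b Ca Fab; apply (HN N (le_n N) a Ca); now apply edge_in_endpoints with b.
  + exists (r (S N + M)); split; [apply HM|apply bt]; lia.
Qed.

End TreeEnds.

(** * The tree of classes of a ladder *)

Section LadderTree.
Context {X : topologicalType} {R : nat -> X -> X -> Prop}.
Hypothesis L : ladder X R.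

(* The root [(0, X)] is listed separately so that the tree is nonempty even if [X]
   is empty. *)
Definition tvertex : Type :=
  { p : nat * (X -> Prop) | p = (0, fun _ => True) \/ exists n x, p = (n, R n x) }.

(** The level is stored because a class that does not split at the next depth must still give two
    vertices. *)
Definition level (t : tvertex) : nat := fst (proj1_sig t).
Definition class (t : tvertex) : X -> Prop := snd (proj1_sig t).

Definition node (x : X) (n : nat) : tvertex :=
  exist _ (n, R n x) (or_intror (ex_intro _ n (ex_intro _ x eq_refl))).

Definition root : tvertex := exist _ (0, fun _ => True) (or_introl eq_refl).

Definition parent (s t : tvertex) : Prop :=
  level t = S (level s) /\ forall x, class t x -> class s x.

Definition tadj (s t : tvertex) : Prop := parent s t \/ parent t s.

Lemma tvertex_eq s t : level s = level t -> class s = class t -> s = t.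
Proof.
destruct s as [[n P] Hs], t as [[m Q] Ht]; unfold level, class; simpl.
intros -> ->; f_equal; apply proof_irrelevance.
Qed.

Lemma class_node x n : class (node x n) x.
Proof. apply (ladder_refl X R L). Qed.

Lemma node_eq n x y : R n x y -> node x n = node y n.
Proof.
intros xy; apply tvertex_eq; auto; apply predeqP; intros z; split; intros H.
- apply (ladder_trans X R L) with x; auto; now apply (ladder_sym X R L).
- now apply (ladder_trans X R L) with y.
Qed.

Lemma tvertexP t x : class t x -> t = node x (level t).
Proof.
destruct t as [p Hp]; unfold class; simpl; intros tx.
destruct Hp as [E|[n [y E]]].
- subst p; apply tvertex_eq; auto; apply predeqP; intros y; split; auto.
  intros _; apply (ladder_total X R L).
- subst p; simpl in tx; transitivity (node y n).
  + now apply tvertex_eq.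
  + exact (node_eq n y x tx).
Qed.

Lemma tvertex_cases t : t = root \/ exists x, t = node x (level t).
Proof.
destruct t as [p Hp]; destruct Hp as [E|[n [y E]]]; subst p.
- left; now apply tvertex_eq.
- right; exists y; now apply tvertex_eq.
Qed.

Lemma ladder_mono m n x y : m <= n -> R n x y -> R m x y.
Proof. induction 1; auto; intros; apply IHle, (ladder_decr X R L); auto. Qed.

Lemma node_parent x n : parent (node x n) (node x (S n)).
Proof. split; auto; intros y; apply (ladder_decr X R L). Qed.

Lemma parent_node s t x : parent s t -> class t x -> s = node x (level s).
Proof. intros [_ st] tx; now apply tvertexP, st. Qed.

Lemma parent_child_inhabited s t : parent s t -> exists x, class t x.
Proof.
intros [E _]; destruct (tvertex_cases t) as [->|[x ->]].
- discriminate.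
- exists x; apply class_node.
Qed.

Lemma parent_unique s s' t : parent s t -> parent s' t -> s = s'.
Proof.
intros st s't; destruct (parent_child_inhabited s t st) as [x tx].
rewrite (parent_node s t x st tx), (parent_node s' t x s't tx).
f_equal; destruct st as [E _], s't as [E' _]; lia.
Qed.

Lemma tadj_sym s t : tadj s t -> tadj t s.
Proof. unfold tadj; tauto. Qed.

Lemma ladder_is_tree : is_tree tadj.
Proof.
split; [split; [exact tadj_sym|]|split].
- intros t [[E _]|[E _]]; lia.
- assert (H : forall t, clos_refl_trans tvertex tadj root t).
  { intros t; destruct (tvertex_cases t) as [->|[x ->]]; [apply rt_refl|].
    induction (level t) as [|n IH].
    - replace (node x 0) with root; [apply rt_refl|now apply tvertexP].
    - apply rt_trans with (node x n); auto; apply rt_step; left; apply node_parent. }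
  intros s t; apply rt_trans with root; auto; apply rtc_sym; auto; apply tadj_sym.
- intros n c Hn inj Hc close.
  (* Both cycle neighbours of a vertex of maximal level are its parents, hence equal. *)
  destruct (argmax_nat (fun i => level (c i)) n) as [i [Hi Mi]]; [lia|].
  assert (up : forall j, j < n -> tadj (c i) (c j) -> parent (c j) (c i)).
  { intros j Hj [[E _]|H]; auto; specialize (Mi j Hj); simpl in Mi; lia. }
  set (j := if Nat.eq_dec (S i) n then 0 else S i).
  set (k := if Nat.eq_dec i 0 then Nat.pred n else Nat.pred i).
  assert (Hj : j < n /\ tadj (c i) (c j)).
  { unfold j; destruct (Nat.eq_dec (S i) n) as [E|E].
    - split; [lia|]; subst n; exact close.
    - split; [lia|apply Hc; lia]. }
  assert (Hk : k < n /\ tadj (c i) (c k)).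
  { unfold k; destruct (Nat.eq_dec i 0) as [E|E].
    - split; [lia|]; subst i; now apply tadj_sym.
    - split; [lia|]; apply tadj_sym; replace i with (S (Nat.pred i)) at 2 by lia.
      apply Hc; lia. }
  assert (jk : j = k).
  { apply inj; try tauto; apply parent_unique with (c i); apply up; tauto. }
  unfold j, k in jk.
  destruct (Nat.eq_dec (S i) n), (Nat.eq_dec i 0); lia.
Qed.

Definition tray (x : X) : ray tadj.
Proof.
refine (Ray tvertex tadj (node x) _ _).
- intros m n E; exact (f_equal level E).
- intros n; left; apply node_parent.
Defined.

(** Levels cannot decrease forever. After one step to a child, the ray never returns to a parent, as
    parents are unique and rays injective; its classes then shrink to a point by completeness. *)
Lemma tray_equiv (r : ray tadj) :
  exists x, edge_equiv tadj (tray x) r.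
Proof.
assert (up1 : exists N, parent (r N) (r (S N))).
{ apply NNPP; intros H.
  assert (D : forall k, level (r k) + k = level (r 0)).
  { induction k as [|k IH]; [lia|].
    destruct (ray_adj tadj r k) as [P|[E _]]; [destruct H; eauto|lia]. }
  specialize (D (S (level (r 0)))); lia. }
destruct up1 as [N HN].
assert (up : forall k, parent (r (k + N)) (r (S (k + N)))).
{ induction k as [|k IH]; auto.
  destruct (ray_adj tadj r (S k + N)) as [P|P]; auto.
  assert (E := parent_unique _ _ _ IH P); apply ray_inj in E; lia. }
set (l := level (r N)).
assert (lev : forall k, level (r (k + N)) = k + l).
{ induction k as [|k IH]; auto; destruct (up k) as [E _].
  change (S k + N) with (S (k + N)); lia. }
assert (Hu : forall k, exists x, class (r (S (k + N))) x).
{ intros k; now apply parent_child_inhabited with (r (k + N)). }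
apply boolp.choice in Hu; destruct Hu as [u Hu].
assert (Eu : forall k, r (S (k + N)) = node (u k) (S (k + l))).
{ intros k; rewrite (tvertexP _ _ (Hu k)) at 1; f_equal; exact (lev (S k)). }
destruct (ladder_complete X R L u) as [x Hx].
{ intros k; apply ladder_mono with (S (k + l)); [lia|].
  assert (H := proj2 (up (S k)) _ (Hu (S k))).
  change (S k + N) with (S (k + N)) in H; rewrite Eu in H; exact H. }
(* The tail starts at level [l], so the representative used at level [k + l] is [u (k + l)], which
   [x] matches at exactly that depth. *)
assert (Er : forall k, r (k + N) = node x (k + l)).
{ intros k; assert (H : class (r (k + N)) (u (k + l))).
  { assert (H : forall d, class (r (k + N)) (u (d + k))).
    { induction d as [|d IH].
      - apply (up k), Hu.
      - generalize (Hu (S d + k)); clear IH.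
        assert (D : forall e y, class (r (e + k + N)) y -> class (r (k + N)) y).
        { induction e as [|e IH]; auto; intros y Hy; apply IH.
          apply (up (e + k)); exact Hy. }
        intros H; apply (D (S (S d))); exact H. }
    replace (k + l) with (l + k) by lia; apply H. }
  rewrite (tvertexP _ _ H), (lev k); symmetry; apply node_eq, Hx. }
exists x; intros F.
destruct (ray_tail_conn tadj_sym r F) as [M HM].
destruct (ray_tail_conn tadj_sym (tray x) F) as [M' HM'].
exists (M + M' + N + l); intros m n Hm Hn.
apply rt_trans with (tray x (M + M' + l)); [apply HM'; lia|].
change (tray x (M + M' + l)) with (node x (M + M' + l)).
rewrite <- Er; apply HM; lia.
Qed.

Definition subtree (x : X) (n : nat) (t : tvertex) : Prop :=
  exists y, R n x y /\ exists k, n <= k /\ t = node y k.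

Lemma subtree_region x n : region tadj (subtree x n).
Proof.
assert (top : forall t, subtree x n t ->
  clos_refl_trans tvertex (inside (adj := tadj) (subtree x n)) (node x n) t).
{ intros t [y [xy [k [Hk ->]]]]; rewrite (node_eq n x y xy).
  induction Hk as [|k Hk IH]; [apply rt_refl|].
  apply rt_trans with (node y k); auto; apply rt_step; split; [|split].
  - exists y; eauto.
  - exists y; split; auto; exists (S k); split; auto.
  - left; apply node_parent. }
split; [|split].
- exists (node x n), x; split; [apply (ladder_refl X R L)|eauto].
- intros s t Hs Ht; apply rt_trans with (node x n); auto.
  apply (rtc_sym (inside (adj := tadj) (subtree x n))); auto.
  intros a b [H1 [H2 H3]]; split; auto; split; auto; now apply tadj_sym.
(* Only the edge from the top vertex to its parent leaves the subtree. For [n] equal to 0 the pair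
   is padding: nothing leaves. *)
- exists [(node x n, node x (Nat.pred n))].
  intros s t [y [xy [k [Hk ->]]]] nt [st|ts].
  + destruct nt; destruct (parent_child_inhabited _ _ st) as [z tz].
    assert (yz : R k y z) by (apply st, tz).
    exists z; split.
    * apply (ladder_trans X R L) with y; auto; revert yz; now apply ladder_mono.
    * exists (level t); split; [destruct st as [E _]; simpl in E; rewrite E; auto|].
      now apply tvertexP.
  + assert (Et := parent_node _ _ y ts (class_node y k)).
    destruct ts as [Ek _]; unfold level at 1 in Ek; simpl in Ek.
    destruct (Nat.eq_dec k n) as [->|kn].
    * left; rewrite Et, Ek; simpl; f_equal; [now rewrite <- Ek; apply node_eq|].
      apply node_eq; revert xy; apply ladder_mono; lia.
    * destruct nt; exists y; split; auto; exists (level t); split; [lia|auto].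
Qed.

Lemma tray_in_subtree x y n : tail_in (tray y) (subtree x n) <-> R n x y.
Proof.
split.
- intros [N HN]; destruct (HN (N + n)) as [z [xz [k [Hk E]]]]; [lia|].
  assert (zy : R (N + n) z y).
  { assert (Ek : N + n = k) by exact (f_equal level E).
    assert (H : class (node z k) y) by (rewrite <- E; apply class_node).
    rewrite Ek; exact H. }
  apply (ladder_trans X R L) with z; auto; revert zy; apply ladder_mono; lia.
- intros xy; exists n; intros m Hm; exists y; split; auto; exists m; auto.
Qed.

(** Below the levels of all endpoints of boundary edges of [C], a subtree is connected without these
    edges and meets [C] along [tray x]. *)
Lemma region_contains_subtree x C :
  region tadj C -> tail_in (tray x) C ->
  exists n, forall t, subtree x n t -> C t.
Proof.
intros rC [M HM]; destruct (region_boundary C rC) as [F HF].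
assert (Hb : exists n, forall t, In t (endpoints F) -> level t < n).
{ induction (endpoints F) as [|t l [n Hn]]; [exists 0; simpl; tauto|].
  exists (S (level t + n)); intros s [<-|sl]; [lia|specialize (Hn s sl); lia]. }
destruct Hb as [n Hn]; exists n.
apply (connected_in_absorbed (adj := tadj) C (subtree x n) F); auto.
- exact (proj1 (proj2 (subtree_region x n))).
- intros s t [y [_ [k [Hk ->]]]] Fst.
  apply edge_in_endpoints, Hn in Fst; simpl in Fst.
  unfold level in Fst; simpl in Fst; lia.
- exists (tray x (n + M)); split; [apply HM; lia|].
  exists x; split; [apply (ladder_refl X R L)|exists (n + M); split; [lia|auto]].
Qed.

Lemma ladder_homeomorphic_tree : homeomorphic_to_ends X tadj.
Proof.
set (f := fun x => end_of (tray x)).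
assert (f_mem : forall x, proj1_sig (f x) (tray x)).
{ intros x; apply end_of_mem, tadj_sym. }
assert (f_inj : forall x y, f x = f y -> x = y).
{ intros x y E; apply (ladder_sep X R L); intros n; apply tray_in_subtree.
  apply edge_equiv_tail with (tray x); [|apply subtree_region|].
  - apply (end_mem_equiv tadj_sym (f x)); auto; rewrite E; auto.
  - apply tray_in_subtree, (ladder_refl X R L). }
assert (f_surj : forall w, exists x, f x = w).
{ intros w; destruct (end_has_ray tadj_sym w) as [r wr].
  destruct (tray_equiv r) as [x Hx]; exists x.
  now apply (end_eq tadj_sym _ _ (tray x) r). }
exists f; split.
- apply boolp.choice in f_surj; destruct f_surj as [g Hg].
  exists g; auto; intros x; apply f_inj; auto.
- intros U; split.
  + intros oU w [x Ux <-]; destruct (ladder_basis X R L x U oU Ux) as [n Hn].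
    exists (subtree x n); split; [apply subtree_region|split].
    * apply (end_in_regionP tadj_sym (f x) (tray x)); auto; [apply subtree_region|].
      apply tray_in_subtree, (ladder_refl X R L).
    * intros w Cw; destruct (f_surj w) as [y <-]; exists y; auto; apply Hn.
      apply tray_in_subtree, (end_in_regionP tadj_sym (f y) (tray y)); auto.
      apply subtree_region.
  + intros H; apply open_local; intros x Ux.
    destruct (H (f x)) as [C [rC [Cx CU]]]; [now exists x|].
    apply (end_in_regionP tadj_sym (f x) (tray x)) in Cx; auto.
    destruct (region_contains_subtree x C rC Cx) as [n Hn].
    exists (R n x); split; [apply (ladder_open X R L)|split].
    * apply (ladder_refl X R L).
    * intros y xy; destruct (CU (f y)) as [z Uz E]; [|apply f_inj in E; now subst z].
      apply (end_in_regionP tadj_sym (f y) (tray y)); auto.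
      destruct (proj2 (tray_in_subtree x y n) xy) as [N HN]; exists N; auto.
Qed.

End LadderTree.

Theorem theorem1p1 (X : topologicalType) (V : Type) (adj : V -> V -> Prop) :
  simple_graph adj -> connected_graph adj -> homeomorphic_to_ends X adj ->
  (first_countable X <-> metrizable X) /\
  (metrizable X <-> completely_ultrametrizable X) /\
  (completely_ultrametrizable X <->
     exists (W : Type) (tadj : W -> W -> Prop),
       is_tree tadj /\ homeomorphic_to_ends X tadj).
Proof.
intros [adj_sym _] adj_conn [f [[g gf fg] fo]].
assert (f_inj : forall x y, f x = f y -> x = y).
{ intros a b E; rewrite <- (gf a), E; apply gf. }
assert (f_surj : forall w, exists x, f x = w) by (intros w; exists (g w); apply fg).
assert (lad := ladder_of_first_countable adj_sym adj_conn f f_inj f_surj fo).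
assert (um : completely_ultrametrizable X -> metrizable X).
{ intros [d [dm [_ [dX _]]]]; exists d; auto. }
assert (mf := metrizable_first_countable X).
assert (fu : first_countable X -> completely_ultrametrizable X).
{ intros fc; destruct (lad fc) as [R HR].
  exact (ladder_completely_ultrametrizable X R HR). }
split; [split; auto|split; [split; auto|split]].
(* The given ultrametric only serves to recover first countability; the tree comes from a ladder
   built on the graph. *)
- intros cu; destruct (lad (mf (um cu))) as [R HR].
  exists (tvertex (R := R)), tadj; split;
    [apply ladder_is_tree|apply ladder_homeomorphic_tree]; exact HR.
- intros [W [tadj [tt ht]]]; apply fu; now apply (tree_first_countable tt).
Qed.
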